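(* Let $f\in L^2(I)\setminus\mathcal A^{\psi,b}|_I$ and $h\in L^2(J)$. For $\mu>-1$ let $$g_0(\mu)=(1+\mu\phi)^{-1}P_+\left(\bar b(f-\psi)\vee(1+\mu)\bar b(h-\psi)\right),$$ $$M_0(\mu)=\|\psi+bg_0(\mu)-h\|_{L^2(J)},\qquad e(\mu)=\|\psi+bg_0(\mu)-f\|_{L^2(I)}^2 ,$$ and let $$\xi_0=\phi\left(P_+\left(\bar b(f-\psi)\vee\bar b(h-\psi)\right)\right)-P_+\left(0\vee\bar b(h-\psi)\right),\qquad F(k)=\langle\phi^k\xi_0,\xi_0\rangle_{L^2(\mathbb T)},\quad k\in\{0,1,2,\dots\}.$$ Then for $|\mu|<1$ $$M_0^2(\mu)=M_0^2(0)-\sum_{k=0}^\infty(-1)^k(k+2)F(k)\mu^{k+1},$$ $$e(\mu)=e(0)+2\sum_{k=0}^\infty(-1)^kF(k)\mu^{k+1}+\sum_{k=1}^\infty(-1)^kk\left[F(k)-F(k-1)\right]\mu^{k+1}.$$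
   Context: $\mathbb D$ is the open unit disk of $\mathbb C$ and $\mathbb T$ the unit circle. $\mathbb T=I\cup J$ where $I$ and $J=\mathbb T\setminus I$ are Lebesgue measurable sets, both of positive measure. $L^2$ spaces on $\mathbb T$, $I$, $J$ are taken with respect to the normalized measure $\frac{1}{2\pi}d\theta$, and $\langle u,v\rangle_{L^2(\mathbb T)}=\frac1{2\pi}\int_0^{2\pi}u\bar v\,d\theta$. $H^2$ is the Hardy space of the disk, identified through boundary values with the closed subspace of $L^2(\mathbb T)$ of functions whose Fourier coefficients of negative index vanish; $P_+:L^2(\mathbb T)\to H^2$ is the orthogonal projection. For $u$ on $I$ and $v$ on $J$, $u\vee v$ denotes the function on $\mathbb T$ equal to $u$ on $I$ and to $v$ on $J$ (functions defined on all of $\mathbb T$ being restricted). $z_1,\dots,z_N\in\mathbb D$ are distinct points, $\omega_1,\dots,\omega_N\in\mathbb C$, $\psi\in H^2$ is a fixed function with $\psi(z_j)=\omega_j$ for all $j$, and $b(z)=e^{i\phi_0}\prod_{j=1}^N\frac{z-z_j}{1-\bar z_jz}$ ($\phi_0\in[0,2\pi]$ constant). $\mathcal A^{\psi,b}=\{\psi+bg:\ g\in H^2\}$ and $\mathcal A^{\psi,b}|_I$ is the set of restrictions (traces) to $I$ of its elements. $\phi:H^2\to H^2$, $\phi(F)=P_+(\chi_JF)$, is the Toeplitz operator with symbol the indicator function $\chi_J$; it is self-adjoint with spectrum contained in $[0,1]$, so $1+\mu\phi$ is boundedly invertible on $H^2$ for $\mu>-1$. *)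

(* Defs.v *)
From HB Require Import structures.
From mathcomp Require Import all_boot all_order all_algebra.
From mathcomp Require Import complex.
From mathcomp Require Import all_classical all_reals all_analysis.

Set Implicit Arguments.
Unset Strict Implicit.
Unset Printing Implicit Defensive.

Import Order.TTheory GRing.Theory Num.Theory.
Import numFieldNormedType.Exports.
Local Open Scope classical_set_scope.
Local Open Scope complex_scope.
Local Open Scope ring_scope.

(* The real line with its Lebesgue measurable (not just Borel) sets. *)
Notation leb_line R := (caratheodory_type (@wlength R idfun)^*%mu).

Notation leb_measure := completed_lebesgue_measure.

Section HardySpace.
Variable R : realType.
Local Notation C := (R[i]).
Implicit Types (A I J : set C) (u v w g : C -> C).

Definition cis (t : R) : C := cos t +i* sin t.

Definition circle : set C := [set z : C | `|z| = 1].

(* Subsets of the circle and functions on it are measured through the angle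
   t in [0, 2 pi]; the normalized measure of A is leb_measure (angles A) /
   (2 pi). *)
Definition angles A : set (leb_line R) :=
  [set t : leb_line R | t \in `[0, 2 * pi] /\ A (cis t)].

Definition eq_ae_on A u v : Prop :=
  ae_eq leb_measure (angles A) (u \o cis) (v \o cis).

(* Elements of L^2(A) are represented by functions on C of which only the
   values on A matter, and these only up to eq_ae_on A. *)
Definition L2 A : set (C -> C) := [set u : C -> C |
  [/\ measurable_fun (angles A)
        (fun t : leb_line R => (complex.Re (u (cis t)) : R)),
      measurable_fun (angles A)
        (fun t : leb_line R => (complex.Im (u (cis t)) : R)) &
      (\int[leb_measure]_(t in angles A)
         ((Normc.normc (u (cis t))) ^+ 2)%:E < +oo)%E]].

Definition normL2 A u : R :=
  Num.sqrt ((2 * pi)^-1 *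
    \int[leb_measure]_(t in angles A) ((Normc.normc (u (cis t))) ^+ 2)).

(* The library integrates real functions only, so that complex functions are
   integrated through their real and imaginary parts. *)
Definition mean u : C :=
  (2 * pi)^-1%:C *
  ((\int[leb_measure]_(t in `[0, 2 * pi]) complex.Re (u (cis t)))
   +i* (\int[leb_measure]_(t in `[0, 2 * pi]) complex.Im (u (cis t)))).

Definition inner u v : C := mean (fun z => u z * (v z)^*).

Definition fourier u (n : int) : C := inner u (fun z => z ^ n).

(* H^2 through boundary values. *)
Definition H2 : set (C -> C) :=
  [set u : C -> C | L2 circle u /\ forall n : int, n < 0 -> fourier u n = 0].

(* Value in the open disk of the holomorphic function with boundary values u:
   its Taylor coefficients are the Fourier coefficients of u.  The alias
   R[i]^o carries the topology of C. *)
Definition disk_value u (z : C) : C :=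
  limn (fun n => \sum_(0 <= k < n) fourier u k%:Z * z ^+ k : C^o).

(* P_+ and the inverse of 1 + mu phi are determined up to a.e. equality; xget
   picks a representative. *)
Definition Pplus u : C -> C :=
  xget (cst 0) [set v : C -> C | H2 v /\
    forall w, H2 w -> inner (fun z => u z - v z) w = 0].

Definition vee A u v : C -> C := fun z => if z \in A then u z else v z.

Definition toeplitz J u : C -> C := Pplus (fun z => \1_J z * u z).

Definition toeplitz_inv J (mu : R) w : C -> C :=
  xget (cst 0) [set g : C -> C | H2 g /\
    eq_ae_on circle (fun z => g z + mu%:C * toeplitz J g z) w].

Definition blaschke (phi0 : R) (N : nat) (z : 'I_N -> C) : C -> C := fun x =>
  cis phi0 * \prod_(j < N) ((x - z j) / (1 - (z j)^* * x)).

Definition interpolants (psi b : C -> C) : set (C -> C) :=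
  [set (fun z => psi z + b z * g z) | g in H2].

Definition traces A (S : set (C -> C)) : set (C -> C) :=
  [set u : C -> C | exists2 v, S v & eq_ae_on A u v].

Definition has_sum_from (m : nat) (a : nat -> C) (s : C) : Prop :=
  (fun n => \sum_(m <= k < n) a k : C^o) @ \oo --> (s : C^o).

End HardySpace.

(* Main.v *)
Require Import Defs.
From HB Require Import structures.
From mathcomp Require Import all_boot all_order all_algebra.
From mathcomp Require Import complex ring lra.
From mathcomp Require Import all_classical all_reals all_analysis.
From mathcomp Require Import measurable_realfun.

Set Implicit Arguments.
Unset Strict Implicit.
Unset Printing Implicit Defensive.

Import Order.TTheory GRing.Theory Num.Theory.
Import numFieldNormedType.Exports.
Local Open Scope classical_set_scope.
Local Open Scope complex_scope.
Local Open Scope ring_scope.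

(** The functions [M0 mu] and [e mu] measure, on [J] and on [I], how far the
    solution [g mu] of a linear equation in H^2 is from the data.  Multiplying
    by the conjugate of [b], which is unimodular on the circle, turns
    [psi + b g - h] and [psi + b g - f] into [g - p] with the single function
    [p], equal to [conj b (f - psi)] on [I] and [conj b (h - psi)] on [J].  With
    [phi] the Toeplitz operator of the indicator of [J], the equation reads,
    tested against every [w] in H^2,

      <g mu, w> + mu <1_J g mu, w> = <p, w> + mu <1_J p, w>.

    Subtracting the case [mu = 0] shows that [g mu = g 0 - mu v] where [v]
    solves [(1 + mu phi) v = xi0] ([resolvent_exists]).  Expanding the squared
    norms of [g mu - p] on [J] and on [I], and using that
    [<1_J (g 0 - p), w> = <xi0, w>] while [<g 0 - p, w> = 0] for [w] in H^2,
    leaves only [a 0 = <v, v>] and [a 1 = <phi v, v>] ([error_on_J],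
    [error_on_I]).

    The power series are then summed without expanding the inverse operator.
    Put [a k = <phi^k v, v>].  Since [phi] is symmetric, [F k] is
    [a k + 2 mu a (k + 1) + mu^2 a (k + 2)] ([iter_toeplitz_resolvent]), so that
    [(- mu)^k F k] is the second difference of [c k = (- mu)^k a k].  Series
    of second differences with affine weights telescope
    ([cvg_second_difference]), and the boundary terms vanish because [phi] is a
    contraction and [|mu| < 1].

    It remains to see that the projection and the inverse exist at all, that is
    that the choices made by [Pplus] and [toeplitz_inv] satisfy their
    specifications.  Both come from one application of the Riesz representation
    theorem to H^2 with the form [<u, w> + mu <1_J u, w>], which is equivalent
    to the inner product when [|mu| < 1] ([weighted_projection]); the projection
    is the case [mu = 0].  That needs H^2 to be complete, which is the
    Riesz-Fischer theorem on the circle ([L2_rapid_complete]) together with the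
    continuity of Fourier coefficients ([H2_closed]).

    Almost all the work is done with the real part [rdot] of the inner
    product.  Nothing is lost: replacing [w] by its complex multiples recovers
    the complex identities. *)

(** * Riesz representation in a complete semi-inner product space *)

Section RieszRepresentation.
Variable R : realType.

(** Both the Cauchy-Schwarz inequality and the near-orthogonality of a
    near-minimizer are instances of this discriminant bound. *)
Lemma quadratic_discriminant (a b c : R) : 0 <= c ->
  (forall t, 0 <= a + 2 * b * t + c * t ^+ 2) -> b ^+ 2 <= a * c.
Proof.
rewrite le_eqVlt => /predU1P[<-|c0] q.
  have [->|b0] := eqVneq b 0; first by rewrite expr0n mulr0.
  have := q (- (a + 1) / (2 * b)).
  have -> : a + 2 * b * (- (a + 1) / (2 * b)) +
    0 * (- (a + 1) / (2 * b)) ^+ 2 = - 1 by field.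
  by rewrite ler0N1.
have := q (- b / c).
have -> : a + 2 * b * (- b / c) + c * (- b / c) ^+ 2 = (a * c - b ^+ 2) / c.
  by field; rewrite gt_eqF.
by rewrite pmulr_lge0 ?invr_gt0// subr_ge0.
Qed.

Variables (V : lmodType R) (K : set V) (B : V -> V -> R).
Hypothesis KL : forall a u v, K u -> K v -> K (u + a *: v).
Hypothesis BL : forall a u v w, K u -> K v -> K w ->
  B (u + a *: v) w = B u w + a * B v w.
Hypothesis BC : forall u v, K u -> K v -> B u v = B v u.
Hypothesis B0 : forall u, K u -> 0 <= B u u.

Lemma form_sqrD a u v : K u -> K v ->
  B (u + a *: v) (u + a *: v) = B u u + 2 * B u v * a + B v v * a ^+ 2.
Proof.
move=> Ku Kv; have Kuv := KL a Ku Kv.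
rewrite BL// (BC Ku)// (BC Kv)// !BL// (BC Kv Ku); ring.
Qed.

Lemma form_cauchy_schwarz u v : K u -> K v -> B u v ^+ 2 <= B u u * B v v.
Proof.
move=> Ku Kv; apply: quadratic_discriminant => [|t]; first exact: B0.
by rewrite -form_sqrD//; exact/B0/KL.
Qed.

(** The representing vector is the limit of a minimizing sequence of the energy
    [B u u - 2 l u]. The sequence is chosen so close to the infimum that the
    steps decay geometrically, which is why completeness is asked for such
    sequences only: it spares the extraction of a subsequence when completeness
    is proved. [B] is only a semi-inner product, as functions are not
    identified when they agree almost everywhere. *)
Lemma riesz_representation (l : V -> R) (c : R) : K 0 -> 0 <= c ->
  (forall a u v, K u -> K v -> l (u + a *: v) = l u + a * l v) ->
  (forall w, K w -> l w ^+2 <= c * B w w) ->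
  (forall x : nat -> V, (forall n, K (x n)) ->
    (forall n, B (x n.+1 - x n) (x n.+1 - x n) <= 16^-1 ^+ n) ->
    exists2 y, K y & B (x n - y) (x n - y) @[n --> \oo] --> 0) ->
  exists2 y, K y & forall w, K w -> B y w = l w.
Proof.
move=> K0 c0 lL lb cpl.
pose J u := B u u - 2 * l u.
have JD a u w : K u -> K w ->
    J (u + a *: w) = J u + 2 * (B u w - l w) * a + B w w * a ^+ 2.
  by move=> Ku Kw; rewrite /J form_sqrD// lL//; ring.
(* By [lb], the negation [c + B u u < 2 l u] would give
   [(c - B u u) ^+ 2 < 0]. *)
have Jc u : K u -> - c <= J u.
  move=> Ku; have bu := B0 Ku; have h := lb _ Ku; rewrite /J leNgt.
  apply/negP => lt.
  have lt2 : (c + B u u) ^+ 2 < (2 * l u) ^+ 2.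
    by rewrite ltr_sqr ?nnegrE; lra.
  have : 0 <= (c - B u u) ^+ 2 := sqr_ge0 _.
  nra.
pose d := inf [set J u | u in K].
have Jinf : has_inf [set J u | u in K].
  by split; [exists (J 0), 0|exists (- c) => _ [u Ku <-]; exact: Jc].
have dJ u : K u -> d <= J u.
  by move=> Ku; apply: ge_inf; [exact: Jinf.2|exists u].
have e0 n : 0 < (4 : R)^-1 * 16^-1 ^+ n by rewrite mulr_gt0// exprn_gt0.
have {e0} /choice[x xP] n : exists u, K u /\ J u < d + 4^-1 * 16^-1 ^+ n.
  by have [_ [u Ku <-] ?] := inf_adherent (e0 n) Jinf; exists u.
have Kx n := (xP n).1; have Jx n := (xP n).2.
have KB u v : K u -> K v -> K (u - v).
  by move=> Ku Kv; rewrite -scaleN1r; exact: KL.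
(* The energy at the midpoint of [x n] and [x n.+1] is at least the infimum,
   which bounds the convexity gap [B w w / 4]. *)
have [|y Ky xy] := cpl x Kx.
  move=> n; set w := x n.+1 - x n.
  have Kw : K w by exact: KB.
  have := dJ _ (KL 2^-1 (Kx n) Kw).
  have : J (x n + 1 *: w) = J (x n.+1) by rewrite scale1r addrC subrK.
  rewrite !JD// => J1 J2.
  have := Jx n; have := Jx n.+1.
  rewrite exprS; have : 0 <= (16^-1 : R) ^+ n by rewrite exprn_ge0.
  lra.
exists y => // w Kw; apply/eqP; rewrite -subr_eq0 -sqrf_eq0 eq_le sqr_ge0 andbT.
(* The energy at [x n + t w] is at least [d] for every [t]. *)
have near_l n : (B (x n) w - l w) ^+ 2 <= 4^-1 * 16^-1 ^+ n * B w w.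
  apply: quadratic_discriminant => [|t]; first exact: B0.
  have := dJ _ (KL t (Kx n) Kw); rewrite JD//; have := Jx n; lra.
have near_y n : (B (x n) w - B y w) ^+ 2 <= B (x n - y) (x n - y) * B w w.
  have -> : B (x n) w - B y w = B (x n - y) w.
    by rewrite -scaleN1r BL//; ring.
  by apply: form_cauchy_schwarz => //; exact: KB.
pose s n := 2 * (4^-1 * 16^-1 ^+ n * B w w) +
            2 * (B (x n - y) (x n - y) * B w w).
have s0 : s n @[n --> \oo] --> (0 : R).
  have -> : (0 : R) = 2 * (4^-1 * 0 * B w w) + 2 * (0 * B w w) by ring.
  apply: cvgD; apply: cvgMr.
    apply: cvgMl; apply: cvgMr; apply: cvg_expr.
    by rewrite ger0_norm ?invr_ge0// invf_lt1 ?ltr1n.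
  exact: cvgMl.
apply: (cvgr_to_ge s0); apply: nearW => n.
have := near_l n; have := near_y n; rewrite /s => h1 h2.
have : 0 <= ((B (x n) w - l w) + (B (x n) w - B y w)) ^+ 2 := sqr_ge0 _.
nra.
Qed.
End RieszRepresentation.

(** * The circle, its angle measure and measurable functions *)

Section CircleMeasure.
Variable R : realType.
Local Notation C := R[i].
Local Notation m := (@leb_measure R).
Implicit Types (A : set C) (u v w : C -> C) (t : leb_line R).

Definition full_turn : set (leb_line R) := [set` `[0, 2 * pi]%R].

Lemma angles_circle : angles (@circle R) = full_turn.
Proof.
apply/seteqP; split=> t /=; first by case.
move=> tD; split => //; rewrite /circle/= normc_def/=.
by rewrite cos2Dsin2 sqrtr1.
Qed.

Lemma cis_circle t : circle (cis t).
Proof. by rewrite /circle/= normc_def/= cos2Dsin2 sqrtr1. Qed.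

Lemma leb_id_measurable (D : set (leb_line R)) :
  measurable_fun D (fun t : leb_line R => t : R).
Proof.
move=> mD Y mY; apply: measurableI => //.
by apply: sub_caratheodory.
Qed.

Lemma measurable_full_turn : measurable full_turn.
Proof.
have := @leb_id_measurable setT measurableT [set` `[0, 2 * pi]%R].
by rewrite setTI; apply.
Qed.

Lemma leb_measure_full_turn : m full_turn = (2 * pi)%:E.
Proof.
have -> : m full_turn = @lebesgue_measure R [set` `[0, 2 * pi]%R] by [].
by rewrite lebesgue_measure_itv/= lte_fin mulr_gt0 ?pi_gt0// oppr0 adde0.
Qed.
End CircleMeasure.

Section MeasurableOnCircle.
Variable R : realType.
Local Notation C := R[i].
Implicit Types (A : set C) (u v w : C -> C).

Definition circle_measurable u :=
  measurable_fun (@full_turn R)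
    (fun t : leb_line R => complex.Re (u (cis t)) : R) /\
  measurable_fun (@full_turn R)
    (fun t : leb_line R => complex.Im (u (cis t)) : R).

Lemma circle_measurable_ext u v : {in @circle R, u =1 v} ->
  circle_measurable u -> circle_measurable v.
Proof.
move=> uv [mr mi]; split.
  by apply: eq_measurable_fun mr => t _; rewrite uv// inE; exact: cis_circle.
by apply: eq_measurable_fun mi => t _; rewrite uv// inE; exact: cis_circle.
Qed.

Lemma circle_measurable_cst (a : C) : circle_measurable (cst a).
Proof. by split; exact: measurable_cst. Qed.

Lemma circle_measurable_id : circle_measurable id.
Proof.
by split; apply: (measurableT_comp (f := _ : R -> R));
  [apply: continuous_measurable_fun; exact: continuous_cos|
   exact: leb_id_measurable|
   apply: continuous_measurable_fun; exact: continuous_sin|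
   exact: leb_id_measurable].
Qed.

Lemma circle_measurableD u v : circle_measurable u -> circle_measurable v ->
  circle_measurable (fun z => u z + v z).
Proof.
move=> [ur ui] [vr vi]; split.
  have := measurable_funD ur vr; apply: eq_measurable_fun => t _ /=.
  by case: (u _) (v _) => [? ?] [].
have := measurable_funD ui vi; apply: eq_measurable_fun => t _ /=.
by case: (u _) (v _) => [? ?] [].
Qed.

Lemma circle_measurableM u v : circle_measurable u -> circle_measurable v ->
  circle_measurable (fun z => u z * v z).
Proof.
move=> [ur ui] [vr vi]; split.
  have := measurable_funB (measurable_funM ur vr) (measurable_funM ui vi).
  by apply: eq_measurable_fun => t _ /=; case: (u _) (v _) => [? ?] [].
have := measurable_funD (measurable_funM ur vi) (measurable_funM ui vr).
by apply: eq_measurable_fun => t _ /=; case: (u _) (v _) => [? ?] [].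
Qed.

Lemma circle_measurableB u v : circle_measurable u -> circle_measurable v ->
  circle_measurable (fun z => u z - v z).
Proof.
move=> [ur ui] [vr vi]; split.
  have := measurable_funB ur vr; apply: eq_measurable_fun => t _ /=.
  by case: (u _) (v _) => [? ?] [].
have := measurable_funB ui vi; apply: eq_measurable_fun => t _ /=.
by case: (u _) (v _) => [? ?] [].
Qed.

Lemma circle_measurable_conj u : circle_measurable u ->
  circle_measurable (fun z => (u z)^*).
Proof.
move=> [ur ui]; split.
  by apply: eq_measurable_fun ur => t _; case: (u _).
have := measurable_funN ui.
by apply: eq_measurable_fun => t _ /=; case: (u _).
Qed.

(** The squared modulus as a real number; being polynomial in the real and
    imaginary parts it is easier to measure and integrate than the modulus. *)
Definition sqmod (x : C) : R := complex.Re x ^+ 2 + complex.Im x ^+ 2.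

Lemma sqmod_ge0 x : 0 <= sqmod x.
Proof. by rewrite addr_ge0 ?sqr_ge0. Qed.

Lemma sqmodE x : sqmod x = Normc.normc x ^+ 2.
Proof.
by case: x => a b; rewrite sqr_sqrtr// addr_ge0 ?sqr_ge0.
Qed.

Lemma sqmod_eq0 x : (sqmod x == 0) = (x == 0).
Proof.
rewrite /sqmod paddr_eq0 ?sqr_ge0// !sqrf_eq0 eq_complex.
by case: x.
Qed.

Lemma sqmodM x y : sqmod (x * y) = sqmod x * sqmod y.
Proof. by rewrite !sqmodE Normc.normcM exprMn. Qed.

Lemma sqmodV x : sqmod x^-1 = (sqmod x)^-1.
Proof. by rewrite !sqmodE Normc.normcV exprVn. Qed.

Lemma sqmodC x : sqmod x^* = sqmod x.
Proof. by case: x => a b; rewrite /sqmod/= sqrrN. Qed.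

Lemma sqmod_conj x : x * x^* = (sqmod x)%:C.
Proof.
case: x => a b; apply/eqP; rewrite eq_complex/= /sqmod/=.
by apply/andP; split; apply/eqP; ring.
Qed.

Lemma sqmod_circle (x : C) : circle x -> sqmod x = 1.
Proof.
rewrite /circle/= => x1; have : (sqmod x)%:C = 1 :> C.
  by rewrite /sqmod add_Re2_Im2 x1 expr1n.
by case.
Qed.

Lemma circle_measurable_sqmod u : circle_measurable u ->
  measurable_fun (@full_turn R) (fun t : leb_line R => sqmod (u (cis t))).
Proof. by move=> [ur ui]; apply: measurable_funD; exact: measurable_funX. Qed.

Lemma circle_measurableV u : circle_measurable u ->
  (forall z, circle z -> u z != 0) -> circle_measurable (fun z => (u z)^-1).
Proof.
move=> mu u0.
(* The inverse is [conj u / |u|^2], and [1 / |u|^2] is written with the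
   measurable functions [expR] and [ln]. *)
pose n z : C := (expR (- ln (sqmod (u z))))%:C.
have mn : circle_measurable n.
  split; last exact: measurable_cst.
  apply: (measurableT_comp (f := expR)); first exact: measurable_expR.
  apply: measurable_funN.
  apply: (measurableT_comp (f := @ln R)); first exact: measurable_ln.
  exact: circle_measurable_sqmod.
have := circle_measurableM mn (circle_measurable_conj mu).
apply: circle_measurable_ext.
move=> z; rewrite inE => /u0 uz0.
have s0 : 0 < sqmod (u z) by rewrite lt_neqAle eq_sym sqmod_eq0 uz0 sqmod_ge0.
rewrite /n expRN lnK ?posrE//; apply: (mulfI uz0); rewrite mulfV//.
by rewrite mulrCA sqmod_conj -rmorphM/= mulVf ?gt_eqF.
Qed.

Lemma mem_angles A (t : leb_line R) : t \in @full_turn R ->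
  (t \in angles A) = (cis t \in A).
Proof.
rewrite inE => tD; apply/idP/idP; rewrite !inE; first by case.
by move=> At; split.
Qed.

Lemma circle_measurable_indic A : measurable (angles A) ->
  circle_measurable (\1_A).
Proof.
move=> mA; split.
  have : measurable_fun (@full_turn R) (\1_(angles A) : leb_line R -> R).
    exact: measurable_indic.
  apply: eq_measurable_fun => t tD; rewrite !indicE mem_angles//.
  by case: (_ \in _).
have : measurable_fun (@full_turn R) (cst 0 : leb_line R -> R).
  exact: measurable_cst.
by apply: eq_measurable_fun => t _; rewrite indicE; case: (_ \in _).
Qed.
End MeasurableOnCircle.

(** * Square integrable functions on the circle *)

Section SquareIntegrable.
Variable R : realType.
Local Notation C := R[i].
Local Notation m := (@leb_measure R).
Local Notation full_turn := (@full_turn R).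
Local Notation T := (@circle R).
Implicit Types (A : set C) (u v w : C -> C).

Lemma L2_circleP u : L2 T u <-> circle_measurable u /\
  m.-integrable full_turn (EFin \o (fun t : leb_line R => sqmod (u (cis t)))).
Proof.
rewrite /L2/= angles_circle; have eu :
    (\int[m]_(t in full_turn) `|(sqmod (u (cis t)))%:E| =
     \int[m]_(t in full_turn) (Normc.normc (u (cis t)) ^+ 2)%:E)%E.
  by apply: eq_integral => t _; rewrite sqmodE gee0_abs// lee_fin sqr_ge0.
split=> [[ur ui fin]|[[ur ui] /integrableP[mu fin]]].
  split => //; apply/integrableP; split; last by rewrite /comp eu.
  by apply/measurable_EFinP; exact: circle_measurable_sqmod.
by split => //; rewrite -eu.
Qed.

Lemma L2_ext u v : {in T, u =1 v} -> L2 T u -> L2 T v.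
Proof.
move=> uv /L2_circleP[mu iu]; apply/L2_circleP; split.
  exact: circle_measurable_ext mu.
apply: eq_integrable iu; first exact: measurable_full_turn.
by move=> t _ /=; rewrite uv// inE; exact: cis_circle.
Qed.

Lemma L2_measurable u : L2 T u -> circle_measurable u.
Proof. by case/L2_circleP. Qed.

Lemma L2_dom u (f : leb_line R -> R) : circle_measurable u ->
  (forall t, sqmod (u (cis t)) <= f t) -> m.-integrable full_turn (EFin \o f) ->
  L2 T u.
Proof.
move=> mu uf fi; apply/L2_circleP; split => //.
apply: le_integrable fi; first exact: measurable_full_turn.
  by apply/measurable_EFinP; exact: circle_measurable_sqmod.
move=> t _ /=; rewrite lee_fin ger0_norm ?sqmod_ge0//.
exact: le_trans (uf t) (ler_norm _).
Qed.

Lemma L2_mul w u (c : R) : circle_measurable w ->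
  (forall z, T z -> sqmod (w z) <= c) -> L2 T u -> L2 T (fun z => w z * u z).
Proof.
move=> mw wc /L2_circleP[mu iu].
apply: (@L2_dom _ (fun t => c * sqmod (u (cis t)))).
- exact: circle_measurableM.
- by move=> t; rewrite sqmodM ler_wpM2r ?sqmod_ge0// wc//; exact: cis_circle.
- have := integrableZl (@measurable_full_turn R) c iu.
  apply: eq_integrable => [|t _]; first exact: measurable_full_turn.
  by rewrite /= EFinM.
Qed.

Lemma L2D u v : L2 T u -> L2 T v -> L2 T (fun z => u z + v z).
Proof.
move=> /L2_circleP[mu iu] /L2_circleP[mv iv].
apply: (@L2_dom _
    (fun t => 2 * sqmod (u (cis t)) + 2 * sqmod (v (cis t)))).
- exact: circle_measurableD.
- move=> t; case: (u _) (v _) => [a b] [c d]; rewrite /sqmod/=.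
  have := sqr_ge0 (a - c); have := sqr_ge0 (b - d); nra.
- have := integrableD (@measurable_full_turn R)
    (integrableZl (@measurable_full_turn R) 2 iu)
    (integrableZl (@measurable_full_turn R) 2 iv).
  apply: eq_integrable => [|t _]; first exact: measurable_full_turn.
  by rewrite /= [in RHS]EFinD !EFinM.
Qed.

Lemma L2Z (a : C) u : L2 T u -> L2 T (fun z => a * u z).
Proof.
apply: (@L2_mul (cst a) _ (sqmod a)) => [|z _ //].
exact (circle_measurable_cst a).
Qed.

Lemma L2B u v : L2 T u -> L2 T v -> L2 T (fun z => u z - v z).
Proof.
move=> u2 /(L2Z (-1)) v2; apply: L2_ext (L2D u2 v2) => z _.
by rewrite mulN1r.
Qed.

Lemma L2_cst (a : C) : L2 T (cst a).
Proof.
apply: (@L2_dom _ (cst (sqmod a))) => //.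
apply/integrableP; split.
  by apply/measurable_EFinP; exact: measurable_cst.
rewrite (eq_integral (cst (`|(sqmod a)%:E|)%E))//.
rewrite integral_cst; last exact: measurable_full_turn.
rewrite [X in (_ * X)%E](leb_measure_full_turn R).
exact: ltry.
Qed.
End SquareIntegrable.

(** * The real part of the inner product *)

Section RealInnerProduct.
Variable R : realType.
Local Notation C := R[i].
Local Notation m := (@leb_measure R).
Local Notation T := (@circle R).
Local Notation full_turn := (@full_turn R).
Implicit Types (A : set C) (u v w : C -> C).

Definition rdot u v : R := complex.Re (inner u v).

Lemma rdotE u v : rdot u v = (2 * pi)^-1 *
  \int[m]_(t in full_turn) complex.Re (u (cis t) * (v (cis t))^*).
Proof. by rewrite /rdot /inner /mean/= mul0r subr0. Qed.

Lemma rdot_ext u v u' v' : {in T, u =1 u'} -> {in T, v =1 v'} ->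
  rdot u v = rdot u' v'.
Proof.
move=> uu vv; rewrite !rdotE; congr (_ * _).
by apply: eq_Rintegral => t _; rewrite uu ?vv// inE; exact: cis_circle.
Qed.

Lemma inner_ext u v u' v' : {in T, u =1 u'} -> {in T, v =1 v'} ->
  inner u v = inner u' v'.
Proof.
move=> uu vv; rewrite /inner /mean; congr (_ * (_ +i* _));
by apply: eq_Rintegral => t _; rewrite uu ?vv// inE; exact: cis_circle.
Qed.

Lemma rdotC u v : rdot u v = rdot v u.
Proof.
rewrite !rdotE; congr (_ * _); apply: eq_Rintegral => t _.
by case: (u _) (v _) => [a b] [c d] /=; ring.
Qed.

Lemma rdot_mul w u v :
  rdot (fun z => w z * u z) v = rdot u (fun z => (w z)^* * v z).
Proof.
rewrite !rdotE; congr (_ * _); apply: eq_Rintegral => t _.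
by case: (u _) (v _) (w _) => [a b] [c d] [e f] /=; ring.
Qed.

(** The imaginary part of [<u, v>] is the real part of [<u, i v>], so that
    [rdot] determines the complex inner product. *)
Lemma inner_rdot u v :
  inner u v = rdot u v +i* rdot u (fun z => 'i * v z).
Proof.
rewrite !rdotE /inner /mean; apply/eqP; rewrite eq_complex/=.
rewrite !mul0r subr0 addr0 eqxx/=; apply/eqP; congr (_ * _).
apply: eq_Rintegral => t _.
by case: (u _) (v _) => [a b] [c d] /=; ring.
Qed.

(** Pointwise, [|Re (u conj v)| <= |u|^2 + |v|^2]. *)
Lemma integrable_dot u v : L2 T u -> L2 T v -> m.-integrable full_turn
  (EFin \o (fun t : leb_line R => complex.Re (u (cis t) * (v (cis t))^*))).
Proof.
move=> /L2_circleP[mu iu] /L2_circleP[mv iv].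
have mF := @measurable_full_turn R.
have iuv := integrableD mF iu iv.
apply: le_integrable iuv => //.
  apply/measurable_EFinP.
  by have [] := circle_measurableM mu (circle_measurable_conj mv).
move=> t _ /=; rewrite lee_fin [leRHS]ger0_norm; last first.
  by rewrite addr_ge0 ?sqmod_ge0.
case: (u _) (v _) => [a b] [c d]; rewrite /sqmod/= ler_norml.
have := sqr_ge0 (a - c); have := sqr_ge0 (a + c).
have := sqr_ge0 (b - d); have := sqr_ge0 (b + d).
by move=> *; apply/andP; split; nra.
Qed.

Lemma rdotDl u v w : L2 T u -> L2 T v -> L2 T w ->
  rdot (fun z => u z + v z) w = rdot u w + rdot v w.
Proof.
move=> u2 v2 w2; rewrite !rdotE -mulrDr; congr (_ * _).
rewrite -RintegralD; [|exact: measurable_full_turn|exact: integrable_dot..].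
apply: eq_Rintegral => t _.
by case: (u _) (v _) (w _) => [a b] [c d] [e f] /=; ring.
Qed.

Lemma rdotZl (a : R) u v : L2 T u -> L2 T v ->
  rdot (fun z => a%:C * u z) v = a * rdot u v.
Proof.
move=> u2 v2; rewrite !rdotE [RHS]mulrCA; congr (_ * _).
rewrite -RintegralZl; [|exact: measurable_full_turn|exact: integrable_dot].
apply: eq_Rintegral => t _.
by case: (u _) (v _) => [b c] [d e] /=; ring.
Qed.

Lemma rdotBl u v w : L2 T u -> L2 T v -> L2 T w ->
  rdot (fun z => u z - v z) w = rdot u w - rdot v w.
Proof.
move=> u2 v2 w2; have := rdotDl u2 (L2Z (-1)%:C v2) w2.
rewrite (rdotZl (-1) v2 w2) mulN1r => <-.
by apply: rdot_ext => // z _; rewrite rmorphN1 mulN1r.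
Qed.

Lemma rdot_sqDZ (a : R) u v : L2 T u -> L2 T v ->
  rdot (fun z => u z + a%:C * v z) (fun z => u z + a%:C * v z) =
  rdot u u + 2 * rdot u v * a + rdot v v * a ^+ 2.
Proof.
move=> u2 v2; have av2 := L2Z a%:C v2; have s2 := L2D u2 av2.
rewrite (rdotDl u2 av2 s2) (rdotZl a v2 s2) (rdotC u) (rdotC v).
rewrite (rdotDl u2 av2 u2) (rdotDl u2 av2 v2) (rdotZl a v2 u2) (rdotZl a v2 v2).
by rewrite (rdotC v u); ring.
Qed.

Lemma rdot_sqE u : rdot u u =
  (2 * pi)^-1 * \int[m]_(t in full_turn) sqmod (u (cis t)).
Proof.
by rewrite rdotE; congr (_ * _); apply: eq_Rintegral => t _; rewrite sqmod_conj.
Qed.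

Lemma twopi_gt0 : 0 < 2 * pi :> R.
Proof. by rewrite mulr_gt0// pi_gt0. Qed.

Lemma rdot_ge0 u : 0 <= rdot u u.
Proof.
rewrite rdot_sqE mulr_ge0 ?invr_ge0 ?(ltW twopi_gt0)//.
by apply: Rintegral_ge0 => t _; exact: sqmod_ge0.
Qed.

Lemma rdot_eq0 u : L2 T u -> rdot u u = 0 -> eq_ae_on T u (cst 0).
Proof.
move=> /L2_circleP[mu iu]; rewrite rdot_sqE => /eqP.
rewrite mulf_eq0 invr_eq0 (gt_eqF twopi_gt0)/= => /eqP int0.
rewrite /eq_ae_on angles_circle.
have /ae_eq_integral_abs : (\int[m]_(t in full_turn)
    `|(EFin \o (fun t : leb_line R => sqmod (u (cis t)))) t| = 0)%E.
  under eq_integral do rewrite /= ger0_norm ?sqmod_ge0//.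
  rewrite -(fineK (integrable_fin_num (@measurable_full_turn R) iu)).
  by congr (_%:E).
have mF := @measurable_full_turn R.
move=> /(_ mF) h; have {h} := h _.
move=> h; have {h} : ae_eq m full_turn
   (EFin \o (fun t : leb_line R => sqmod (u (cis t)))) (cst 0).
  by apply: h; apply/measurable_EFinP; exact: circle_measurable_sqmod.
apply: filterS => t /= tu /tu [] /eqP.
by rewrite sqmod_eq0 => /eqP.
Qed.

Lemma rdot_ae u v w : eq_ae_on T u v -> L2 T u -> L2 T v -> L2 T w ->
  rdot u w = rdot v w.
Proof.
move=> uv u2 v2 w2; rewrite !rdotE /Rintegral; congr (_ * fine _).
apply: ae_eq_integral.
- exact: measurable_full_turn.
- by have /integrableP[] := integrable_dot u2 w2.
- by have /integrableP[] := integrable_dot v2 w2.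
- move: uv; rewrite /eq_ae_on angles_circle; apply: filterS => t /= uv /uv.
  by move=> ->.
Qed.

Lemma indic_mul A u (t : leb_line R) : t \in full_turn ->
  \1_A (cis t) * u (cis t) = if t \in angles A then u (cis t) else 0.
Proof.
move=> tD; rewrite mem_angles// indicE.
by case: (_ \in _); rewrite ?mul1r ?mul0r.
Qed.

Lemma sqmod0 : sqmod (0 : C) = 0 :> R.
Proof. by rewrite /sqmod/= expr0n addr0. Qed.

Lemma sqmod1 : sqmod (1 : C) = 1 :> R.
Proof. by rewrite /sqmod/= expr0n expr1n addr0. Qed.

Lemma angles_setI A : angles A = full_turn `&` angles A.
Proof. by apply/seteqP; split => t; [move=> [tD At]; split|case]. Qed.

(** Norms over a subset of the circle become [rdot] of truncated functions, so
    that all the computations take place in L^2 of the whole circle. *)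
Lemma normL2_sqE A u :
  normL2 A u ^+ 2 = rdot (fun z => \1_A z * u z) (fun z => \1_A z * u z).
Proof.
rewrite /normL2 rdot_sqE sqr_sqrtr; last first.
  rewrite mulr_ge0 ?invr_ge0 ?(ltW twopi_gt0)//.
  by apply: Rintegral_ge0 => t _; exact: sqr_ge0.
congr (_ * _); rewrite angles_setI Rintegral_mkcondr.
apply: eq_Rintegral => t tD; rewrite indic_mul// patchE.
by case: ifP; rewrite ?sqmod0// sqmodE.
Qed.

Lemma L2_indic A u : measurable (angles A) -> L2 A u ->
  L2 T (fun z => \1_A z * u z).
Proof.
move=> mA [ur ui fin].
have mu : circle_measurable (fun z => \1_A z * u z).
  by split; [move: ur|move: ui]; rewrite {1}angles_setI => h;
    have /measurable_restrict := h; move=> /(_ mA (@measurable_full_turn R));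
    apply: eq_measurable_fun => t tD; rewrite patchE indic_mul//; case: ifP.
apply/L2_circleP; split => //; apply/integrableP; split.
  by apply/measurable_EFinP; exact: (circle_measurable_sqmod mu).
move: fin; rewrite angles_setI integral_mkcondr; apply: le_lt_trans.
rewrite le_eqVlt; apply/orP; left; apply/eqP; apply: eq_integral => t tD /=.
rewrite indic_mul// patchE ger0_norm ?sqmod_ge0//.
by case: ifP; rewrite ?sqmod0// sqmodE.
Qed.
End RealInnerProduct.

(** * Completeness of L^2 of the circle *)

Section Completeness.
Variable R : realType.
Local Notation C := R[i].
Local Notation m := (@leb_measure R).
Local Notation T := (@circle R).
Local Notation full_turn := (@full_turn R).
Implicit Types (A : set C) (u v w : C -> C).

Lemma cvg_geometric_steps (a : nat -> R) (s : R) :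
  (forall n, 4 ^+ n * (a n.+1 - a n) ^+ 2 <= s) -> cvgn a.
Proof.
move=> step.
have s0 : 0 <= s by apply: le_trans (step 0%N); rewrite mulr_ge0 ?sqr_ge0.
have cvgS : cvgn (series (telescope a)).
  apply: normed_cvg; apply: (@series_le_cvg _ _ (geometric (s + 1) 2^-1)).
  - by move=> n; exact: normr_ge0.
  - by move=> n; rewrite mulr_ge0 ?exprn_ge0//; lra.
  - move=> n; rewrite /geometric /telescope/= exprVn ler_pdivlMr ?exprn_gt0//.
    have := step n; rewrite (_ : 4 = 2 ^+ 2 :> R); last by ring.
    rewrite exprAC -exprMn mulrC.
    rewrite -(real_normK (num_real (_ * _))) normrM.
    rewrite (ger0_norm (exprn_ge0 n _))//.
    set p := (X in X ^+ 2) => ps; have := sqr_ge0 (p - 1).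
    rewrite -/p; nra.
  - by apply: is_cvg_geometric_series; rewrite ger0_norm; lra.
rewrite telescopeK in cvgS.
have -> : a = (fun n => (a n - a 0%N) + a 0%N).
  by apply/funext => n; rewrite subrK.
by apply: is_cvgD => //; exact: is_cvg_cst.
Qed.

(** The extended real form of the squared norm, as needed by the convergence
    theorems. *)
Lemma integral_sqmod u : L2 T u ->
  (\int[m]_(t in full_turn) (sqmod (u (cis t)))%:E =
   (2 * pi * rdot u u)%:E)%E.
Proof.
move=> /L2_circleP[mu iu].
rewrite rdot_sqE mulrA mulfV ?mul1r ?gt_eqF ?twopi_gt0//.
by rewrite fineK// integrable_fin_num//; exact: measurable_full_turn.
Qed.

Lemma rdot_sqD_le u v : L2 T u -> L2 T v ->
  rdot (fun z => u z + v z) (fun z => u z + v z) <= 2 * rdot u u + 2 * rdot v v.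
Proof.
move=> u2 v2; have := rdot_ge0 (fun z => u z + (-1)%:C * v z).
rewrite (rdot_sqDZ (-1) u2 v2); have := rdot_sqDZ 1 u2 v2.
rewrite (_ : (fun z => u z + 1%:C * v z) = (fun z => u z + v z)).
  by move=> ->; lra.
by apply/funext => z; rewrite mul1r.
Qed.

Lemma cvg_fine_limn_esup (a : nat -> R) : cvgn a ->
  a n @[n --> \oo] --> fine (limn_esup (fun n => (a n)%:E)).
Proof.
move=> ca; have : (fun n => (a n)%:E) @ \oo --> (limn a)%:E.
  by apply: cvg_EFin => //; exact: nearW.
by move=> /cvg_limn_einf_sup[_ ->].
Qed.

Variables (x : nat -> C -> C) (M : R).
Hypothesis x2 : forall n, L2 T (x n).
Hypothesis xM : forall n,
  rdot (fun z => x n.+1 z - x n z) (fun z => x n.+1 z - x n z) <=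
  M * 16^-1 ^+ n.

(** Splitting off the first step and using [|a + b|^2 <= 2 |a|^2 + 2 |b|^2]
    loses a factor 2 at each step, which the rate [16^-1] absorbs. *)
Lemma rapid_sq_bound k n :
  rdot (fun z => x (k + n)%N z - x n z) (fun z => x (k + n)%N z - x n z)
    <= 4 * M * 16^-1 ^+ n.
Proof.
have M0 : 0 <= M.
  by have := le_trans (rdot_ge0 _) (xM 0%N); rewrite mulr1.
elim: k n => [|k IH] n.
  have -> : rdot (fun z => x (0 + n)%N z - x n z)
     (fun z => x (0 + n)%N z - x n z) = 0.
    rewrite (_ : (fun z => _ - _) = (fun z => (0 : R)%:C * x n z)).
      by rewrite (rdotZl 0 (x2 n) (L2Z _ (x2 n))) mul0r.
    by apply/funext => z; rewrite add0n subrr mul0r.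
  by rewrite !mulr_ge0 ?exprn_ge0.
have -> : (fun z => x (k.+1 + n)%N z - x n z) =
   (fun z => (x (k + n.+1)%N z - x n.+1 z) + (x n.+1 z - x n z)).
  by apply/funext => z; rewrite addSnnS addrA subrK.
apply: le_trans (rdot_sqD_le _ _) _; try exact: L2B.
have := IH n.+1; have := xM n; rewrite exprS.
have : 0 <= M * 16^-1 ^+ n by rewrite mulr_ge0 ?exprn_ge0.
lra.
Qed.

(** The integral of [\sum_n 4^n |x (n + 1) - x n|^2] is finite, so this series
    converges almost everywhere; there the steps of [x n] are [O(2^-n)]. *)
Lemma rapid_cvg_ae : {ae m, forall t, full_turn t ->
  cvgn (fun n => complex.Re (x n (cis t))) /\
  cvgn (fun n => complex.Im (x n (cis t)))}.
Proof.
have mF := @measurable_full_turn R.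
have M0 : 0 <= M by have := le_trans (rdot_ge0 _) (xM 0%N); rewrite mulr1.
pose d n t : R := sqmod (x n.+1 (cis t) - x n (cis t)).
pose f n (t : leb_line R) : \bar R := (4 ^+ n * d n t)%:E.
have d2 n := L2B (x2 n.+1) (x2 n).
have f0 n t : (0 <= f n t)%E.
  by rewrite lee_fin mulr_ge0 ?exprn_ge0// sqmod_ge0.
have mf n : measurable_fun full_turn (f n).
  apply/measurable_EFinP; apply: measurable_funM; first exact: measurable_cst.
  exact: (circle_measurable_sqmod (L2_measurable (d2 n))).
have intf n : (\int[m]_(t in full_turn) f n t <= (2 * pi * M * 4^-1 ^+ n)%:E)%E.
  rewrite /f; under eq_integral do rewrite EFinM.
  rewrite integralZl//; last by have [] := (L2_circleP _).1 (d2 n).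
  rewrite [X in (_ * X)%E](integral_sqmod (d2 n)) -EFinM lee_fin.
  rewrite (_ : 4^-1 = 4 * 16^-1 :> R); last by field.
  rewrite (_ : _ * _ ^+ n = 4 ^+ n * (2 * pi * (M * 16^-1 ^+ n))); last first.
    by rewrite exprMn; ring.
  rewrite ler_wpM2l ?exprn_ge0// ler_wpM2l// ltW//; exact: twopi_gt0.
pose S t := (\sum_(0 <= n <oo) f n t)%E.
have S0 t : (0 <= S t)%E by apply: nneseries_ge0 => n _ _; exact: f0.
have mS : measurable_fun full_turn S.
  have := @ge0_emeasurable_sum _ _ R full_turn f xpredT
    (fun k t _ _ => f0 k t) (fun k _ => mf k).
  by [].
have iS : m.-integrable full_turn S.
  apply/integrableP; split => //.
  under eq_integral do rewrite gee0_abs//.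
  rewrite integral_nneseries//.
  apply: (@le_lt_trans _ _ (2 * pi * M * 2)%:E); last exact: ltry.
  apply: lime_le.
    by apply: is_cvg_nneseries => n _ _; exact: integral_ge0.
  apply: nearW => k.
  apply: (@le_trans _ _ (\sum_(0 <= n < k) (2 * pi * M * 4^-1 ^+ n)%:E)%E).
    by apply: lee_sum => n _; exact: intf.
  rewrite sumEFin lee_fin -mulr_sumr.
  rewrite ler_wpM2l ?mulr_ge0// ?pi_ge0//.
  have : \sum_(0 <= i < k) (4^-1 : R) ^+ i <= 2 - 2 * 4^-1 ^+ k.
    elim: k => [|k IH]; first by rewrite big_geq// expr0; lra.
    rewrite big_nat_recr//= exprS.
    have : 0 <= (4^-1 : R) ^+ k by rewrite exprn_ge0.
    by move: IH; lra.
  have : 0 <= (4^-1 : R) ^+ k by rewrite exprn_ge0.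
  by lra.
have := integrable_ae mF iS.
apply: filterS => t /= St /St fin.
have step n : 4 ^+ n * d n t <= fine (S t).
  rewrite -lee_fin fineK//.
  have := @nneseries_lim_ge R (f ^~ t) xpredT 0 n.+1 (fun k _ _ => f0 k t).
  apply: le_trans; rewrite big_nat_recr//=.
  by apply: leeDr; apply: sume_ge0 => k _; exact: f0.
split; apply: (@cvg_geometric_steps _ (fine (S t))) => n;
  apply: le_trans (step n); rewrite ler_pM2l ?exprn_gt0// /d /sqmod;
  case: (x _ _) (x _ _) => [? ?] [? ?] /=.
  by rewrite lerDl sqr_ge0.
by rewrite lerDr sqr_ge0.
Qed.

(** The limit is built from upper limits of real and imaginary parts, which
    makes it measurable with no case distinction on convergence. Fatou's lemma,
    applied to [|x (k + n) - x n|^2] as [k] grows, gives both the distance to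
    the limit and its square integrability. *)
Lemma L2_rapid_complete : exists2 y, L2 T y & forall n,
  rdot (fun z => x n z - y z) (fun z => x n z - y z) <= 4 * M * 16^-1 ^+ n.
Proof.
have mF := @measurable_full_turn R.
have mx n := L2_measurable (x2 n).
pose y z : C := fine (limn_esup (fun n => (complex.Re (x n z))%:E)) +i*
                fine (limn_esup (fun n => (complex.Im (x n z))%:E)).
have my : circle_measurable y.
  by split; apply: (measurableT_comp (f := fine)); [exact: fine_measurable| |
      exact: fine_measurable|];
    apply: measurable_fun_limn_esup => n; apply/measurable_EFinP;
    have [] := mx n.
have mxy n : circle_measurable (fun z => x n z - y z).
  exact: (circle_measurableB (mx n) my).
have cvgy : {ae m, forall t, full_turn t ->
    complex.Re (x n (cis t)) @[n --> \oo] --> complex.Re (y (cis t)) /\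
    complex.Im (x n (cis t)) @[n --> \oo] --> complex.Im (y (cis t))}.
  apply: filterS rapid_cvg_ae => t xt /xt[cr ci].
  by split; exact: cvg_fine_limn_esup.
have fatou_y n : (\int[m]_(t in full_turn) (sqmod (x n (cis t) - y (cis t)))%:E
    <= (2 * pi * (4 * M * 16^-1 ^+ n))%:E)%E.
  pose f k (t : leb_line R) := (sqmod (x (k + n)%N (cis t) - x n (cis t)))%:E.
  have d2 k := L2B (x2 (k + n)) (x2 n).
  have mf k : measurable_fun full_turn (f k).
    apply/measurable_EFinP.
    exact: (circle_measurable_sqmod (L2_measurable (d2 k))).
  have f0 k t : full_turn t -> (0 <= f k t)%E.
    by rewrite lee_fin sqmod_ge0.
  have mlim : measurable_fun full_turn (fun t => limn_einf (f ^~ t)).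
    apply: (emeasurable_fun_cvg (fun k t => einfs (f ^~ t) k)).
      exact: measurable_fun_einfs.
    by move=> t _; rewrite limn_einf_lim; exact: is_cvg_einfs.
  have -> : (\int[m]_(t in full_turn) (sqmod (x n (cis t) - y (cis t)))%:E =
      \int[m]_(t in full_turn) limn_einf (f ^~ t))%E.
    apply: (ae_eq_integral _ _ mF _ mlim).
      by apply/measurable_EFinP; exact: (circle_measurable_sqmod (mxy n)).
    apply: filterS cvgy => t yt /yt[cr ci].
    apply/esym; have [] := @cvg_limn_einf_sup _ (f ^~ t)
      (sqmod (x n (cis t) - y (cis t)))%:E _; last by [].
    apply: cvg_EFin; first exact: nearW.
    have -> : sqmod (x n (cis t) - y (cis t)) =
        (complex.Re (y (cis t)) - complex.Re (x n (cis t))) ^+ 2 +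
        (complex.Im (y (cis t)) - complex.Im (x n (cis t))) ^+ 2.
      by case: (x n _) (y _) => [a b] [c e]; rewrite /sqmod/=; ring.
    have fE k : fine (f k t) =
        (complex.Re (x (k + n)%N (cis t)) - complex.Re (x n (cis t))) ^+ 2 +
        (complex.Im (x (k + n)%N (cis t)) - complex.Im (x n (cis t))) ^+ 2.
      rewrite /f/=; case: (x _ _) (x n _) => [a b] [c e].
      by rewrite /sqmod/=; ring.
    suff : ((complex.Re (x (k + n)%N (cis t)) - complex.Re (x n (cis t))) ^+ 2 +
        (complex.Im (x (k + n)%N (cis t)) - complex.Im (x n (cis t))) ^+ 2)
        @[k --> \oo] -->
        (complex.Re (y (cis t)) - complex.Re (x n (cis t))) ^+ 2 +
        (complex.Im (y (cis t)) - complex.Im (x n (cis t))) ^+ 2.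
      by apply: cvg_trans; apply: near_eq_cvg; apply: nearW => k; rewrite -fE.
    have sqr_cvg (a : nat -> R) (l c : R) : a k @[k --> \oo] --> l ->
        (a (k + n)%N - c) ^+ 2 @[k --> \oo] --> (l - c) ^+ 2.
      move=> al; rewrite expr2; under eq_fun do rewrite expr2.
      have {}al : (a (k + n)%N - c) @[k --> \oo] --> l - c.
        by apply: cvgB; [rewrite cvg_shiftn|exact: cvg_cst].
      exact: cvgM.
    by apply: cvgD; [exact: (sqr_cvg _ _ _ cr)|exact: (sqr_cvg _ _ _ ci)].
  apply: (le_trans (fatou m mF mf f0)).
  rewrite limn_einf_lim; apply: lime_le; first exact: is_cvg_einfs.
  apply: nearW => k; apply: ereal_inf_le.
  exists (\int[m]_(t in full_turn) f k t)%E; first by exists k => /=.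
  rewrite (integral_sqmod (d2 k)) lee_fin ler_wpM2l ?(ltW (twopi_gt0 _))//.
  exact: rapid_sq_bound.
have xy2 n : L2 T (fun z => x n z - y z).
  apply/L2_circleP; split => //; apply/integrableP; split.
    by apply/measurable_EFinP; exact: (circle_measurable_sqmod (mxy n)).
  under eq_integral do rewrite /= ger0_norm ?sqmod_ge0//.
  by apply: le_lt_trans (fatou_y n) _; exact: ltry.
exists y => [|n].
  by apply: L2_ext (L2B (x2 0%N) (xy2 0%N)) => z _; rewrite opprB addrC subrK.
have := fatou_y n; rewrite (integral_sqmod (xy2 n)) lee_fin.
by rewrite ler_pM2l// twopi_gt0.
Qed.
End Completeness.

(** * The Hardy space and weighted projections onto it *)

Section HardyProjection.
Variable R : realType.
Local Notation C := R[i].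
Local Notation T := (@circle R).
Implicit Types (A J : set C) (u v w : C -> C) (mu : R).

Lemma mem_circle_setD A x : T x -> (x \in T `\` A) = (x \notin A).
Proof.
by move=> Tx; apply/idP/idP; rewrite !inE notin_setE; [case|split].
Qed.

Definition cutoff J u : C -> C := fun z => \1_J z * u z.

Lemma L2_cutoff J u : measurable (angles J) -> L2 T u -> L2 T (cutoff J u).
Proof.
move=> mJ; apply: (@L2_mul _ _ _ 1); first exact: circle_measurable_indic.
move=> z _; rewrite indicE; case: (_ \in _); last by rewrite sqmod0.
by rewrite sqmod1.
Qed.

Lemma rdot_cutoffC J u v : rdot (cutoff J u) v = rdot u (cutoff J v).
Proof.
rewrite rdot_mul; apply: rdot_ext => // z _; rewrite /cutoff indicE.
by case: (_ \in _); rewrite ?rmorph1 ?rmorph0.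
Qed.

Lemma rdot_cutoff2 J u v : rdot (cutoff J u) (cutoff J v) = rdot (cutoff J u) v.
Proof.
rewrite rdotC rdot_cutoffC rdotC; apply: rdot_ext => // z _.
by rewrite /cutoff mulrA indicE -natrM mulnb andbb.
Qed.

Lemma rdot_cutoff_le J u : measurable (angles J) -> L2 T u ->
  rdot (cutoff J u) u <= rdot u u.
Proof.
move=> mJ u2; have := rdot_ge0 (fun z => u z + (-1)%:C * cutoff J u z).
have c2 := L2_cutoff mJ u2.
by rewrite rdot_sqDZ// rdot_cutoff2 (rdotC u); lra.
Qed.

(** The real module structure on [Rcomplex] scales the two components, which is
    the multiplication by a real complex number. *)
Lemma real_scale_fctE (a : R) (u v : C -> Rcomplex R) :
  u + a *: v = (fun z => u z + a%:C * v z) :> (C -> C).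
Proof.
apply/funext => z; rewrite -[LHS]/(u z + a *: v z); congr (_ + _).
by case: (v z) => b c; apply/eqP; rewrite eq_complex/=; apply/andP; split;
  apply/eqP; ring.
Qed.

Lemma rdot_cauchy_schwarz u v : L2 T u -> L2 T v ->
  rdot u v ^+ 2 <= rdot u u * rdot v v.
Proof.
move=> u2 v2; apply: quadratic_discriminant => [|t]; first exact: rdot_ge0.
by rewrite -rdot_sqDZ//; exact: rdot_ge0.
Qed.

(** Orthogonality in the complex sense is [rdot]-orthogonality to the complex
    line. *)
Lemma inner_eq0P u v : L2 T u -> L2 T v ->
  inner u v = 0 <-> forall c, rdot u (fun z => c * v z) = 0.
Proof.
move=> u2 v2; rewrite inner_rdot; split=> [[re im] [a b]|h].
  rewrite rdotC (_ : (fun z => _) =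
    (fun z => a%:C * v z + b%:C * ('i * v z))); last first.
    apply/funext => z; rewrite mulrA -mulrDl; congr (_ * _).
    by apply/eqP; rewrite eq_complex/=; apply/andP; split; apply/eqP; ring.
  have iv := L2Z 'i v2.
  have av2 := L2Z a%:C v2; have biv2 := L2Z b%:C iv.
  rewrite (rdotDl av2 biv2 u2) (rdotZl a v2 u2) (rdotZl b iv u2).
  by rewrite (rdotC v) re (rdotC _ u) im !mulr0 addr0.
rewrite h (_ : rdot u v = 0)// -[RHS](h 1).
by apply: rdot_ext => // z _; rewrite mul1r.
Qed.

Lemma L2_monomial (n : int) : L2 T (fun z : C => z ^ n).
Proof.
have mX k : circle_measurable (fun z : C => z ^+ k).
  elim: k => [|k IH]; first exact (circle_measurable_cst 1).
  have := circle_measurableM (@circle_measurable_id R) IH.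
  by apply: circle_measurable_ext => z _; rewrite exprS.
have sX (z : C) k : circle z -> sqmod (z ^+ k) = 1.
  move=> Tz; elim: k => [|k IH].
    by rewrite expr0 sqmod1.
  by rewrite exprS sqmodM IH sqmod_circle// mulr1.
have {mX} mX : circle_measurable (fun z : C => z ^ n).
  case: n => k; first exact: mX.
  apply: circle_measurableV => // z Tz.
  by rewrite -sqmod_eq0 sX// oner_eq0.
have := @L2_mul _ _ (cst 1) 1 mX _ (L2_cst 1).
move=> h; apply: L2_ext (h _) => [z _|z Tz]; first by rewrite mulr1.
case: n {mX h} => k; first by rewrite sX.
by rewrite /exprz sqmodV sX// invr1.
Qed.

(** In this form the vanishing of Fourier coefficients is stable under complex
    scaling of [u], since the scalar moves to the test function. *)
Lemma H2P u : H2 u <-> L2 T u /\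
  forall (n : int) c, n < 0 -> rdot u (fun z => c * z ^ n) = 0.
Proof.
split=> -[u2 h]; split => // n.
  by move=> c n0; apply: (inner_eq0P u2 (L2_monomial n)).1; exact: h.
by move=> n0; apply: (inner_eq0P u2 (L2_monomial n)).2 => c; exact: h.
Qed.

Lemma H2_L2 u : H2 u -> L2 T u. Proof. by case. Qed.

Lemma H2D u v : H2 u -> H2 v -> H2 (fun z => u z + v z).
Proof.
move=> /H2P[u2 u0] /H2P[v2 v0]; apply/H2P; split; first exact: L2D.
move=> n c n0; rewrite (rdotDl u2 v2 (L2Z c (L2_monomial n))).
by rewrite u0 ?v0 ?addr0.
Qed.

Lemma H2Z (a : C) u : H2 u -> H2 (fun z => a * u z).
Proof.
move=> /H2P[u2 u0]; apply/H2P; split; first exact: L2Z.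
move=> n c n0; rewrite rdot_mul -[RHS](u0 n (a^* * c) n0).
by apply: rdot_ext => // z _; rewrite mulrA.
Qed.

Lemma H2_0 : H2 (cst 0 : C -> C).
Proof.
apply/H2P; split; first exact: L2_cst.
move=> n c n0; have e2 := L2Z c (L2_monomial n).
have := rdotZl 0 (L2_cst 0) e2; rewrite mul0r => <-.
by apply: rdot_ext => // z _; rewrite mulr0.
Qed.

Lemma H2_closed (x : nat -> C -> C) (y : C -> C) :
  (forall n, H2 (x n)) -> L2 T y ->
  rdot (fun z => x n z - y z) (fun z => x n z - y z) @[n --> \oo] --> 0 ->
  H2 y.
Proof.
move=> Hx y2 xy; apply/H2P; split => // n c n0.
set e := fun z => _; have e2 : L2 T e by apply: L2Z; exact: L2_monomial.
apply/eqP; rewrite -sqrf_eq0 eq_le sqr_ge0 andbT.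
have xy0 : rdot (fun z => x n z - y z) (fun z => x n z - y z) * rdot e e
    @[n --> \oo] --> 0 * rdot e e by exact: cvgMl.
rewrite mul0r in xy0; apply: (cvgr_to_ge xy0); apply: nearW => k.
have x2 := H2_L2 (Hx k).
apply: le_trans (rdot_cauchy_schwarz (L2B x2 y2) e2).
by rewrite rdotBl// ((H2P _).1 (Hx k)).2// sub0r sqrrN.
Qed.

(** As [0 <= <1_J u, u> <= <u, u>], the form [<u, w> + mu <1_J u, w>] lies
    between [1 - |mu|] and [2] times the inner product, so H^2 is complete for
    it as well. For [mu = 0] this is the orthogonal projection onto H^2; in
    general it inverts [1 + mu phi] on H^2. *)
Lemma weighted_projection J mu v : measurable (angles J) -> `|mu| < 1 ->
  L2 T v -> exists2 g, H2 g & forall w, H2 w ->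
  rdot g w + mu * rdot (cutoff J g) w = rdot v w.
Proof.
move=> mJ mu1 v2.
pose B u w := rdot u w + mu * rdot (cutoff J u) w.
have lb u : L2 T u -> (1 - `|mu|) * rdot u u <= B u u.
  move=> u2; have := rdot_cutoff_le mJ u2; have := rdot_ge0 (cutoff J u).
  rewrite rdot_cutoff2 => c0 cu; rewrite /B mulrBl mul1r lerD2l.
  rewrite lerNl -mulNr (le_trans (ler_wpM2r c0 _) (ler_wpM2l _ cu))//.
  by rewrite -normrN ler_norm.
have ub u : L2 T u -> B u u <= 2 * rdot u u.
  move=> u2; have := rdot_cutoff_le mJ u2; have := rdot_ge0 (cutoff J u).
  rewrite rdot_cutoff2 /B; have := ler_norm mu; nra.
have mu0 : 0 < 1 - `|mu| by rewrite subr_gt0.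
have := @riesz_representation R (C -> Rcomplex R) (@H2 R) B _ _ _ _
  (rdot v) (rdot v v / (1 - `|mu|)).
case.
- by move=> a u w Hu Hw; rewrite real_scale_fctE; exact (H2D Hu (H2Z a%:C Hw)).
- move=> a u w x /H2_L2 u2 /H2_L2 w2 /H2_L2 x2; rewrite real_scale_fctE /B.
  have aw2 := L2Z a%:C w2.
  have x2' := L2_cutoff mJ x2.
  rewrite (rdotDl u2 aw2 x2) (rdotZl a w2 x2) (rdot_cutoffC _ (fun z => _ + _)).
  rewrite (rdotDl u2 aw2 x2') (rdotZl a w2 x2').
  by rewrite -!rdot_cutoffC; ring.
- by move=> u w _ _; rewrite /B rdotC rdot_cutoffC (rdotC u).
- move=> u /H2_L2 u2; apply: le_trans (lb _ u2).
  by rewrite mulr_ge0 ?rdot_ge0// ltW.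
- exact: H2_0.
- by rewrite mulr_ge0 ?rdot_ge0// invr_ge0 ltW.
- move=> a u w /H2_L2 u2 /H2_L2 w2; rewrite real_scale_fctE !(rdotC v).
  by rewrite (rdotDl u2 (L2Z a%:C w2) v2) (rdotZl a w2 v2).
- move=> w /H2_L2 w2; apply: le_trans (rdot_cauchy_schwarz v2 w2) _.
  by rewrite mulrAC -mulrA ler_wpM2l ?rdot_ge0// ler_pdivlMr// mulrC lb.
- move=> x Hx step.
  have x2 n := H2_L2 (Hx n).
  have [|y y2 xy] := @L2_rapid_complete R x (1 - `|mu|)^-1 x2.
    move=> n; rewrite mulrC ler_pdivlMr// mulrC.
    exact: le_trans (lb _ (L2B (x2 n.+1) (x2 n))) (step n).
  have xy0 : rdot (fun z => x n z - y z) (fun z => x n z - y z)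
      @[n --> \oo] --> 0.
    apply: (squeeze_cvgr (f := cst 0)
        (h := fun n => 4 * (1 - `|mu|)^-1 * 16^-1 ^+ n)).
    - by apply: nearW => n; rewrite rdot_ge0 xy.
    - exact: cvg_cst.
    - rewrite -[X in _ --> X](mulr0 (4 * (1 - `|mu|)^-1)).
      apply: cvgMr; apply: cvg_expr.
      by rewrite ger0_norm ?invr_ge0// invf_lt1 ?ltr1n.
  exists y; first exact: H2_closed xy0.
  apply: (squeeze_cvgr (f := cst 0)
    (h := fun n => 2 * rdot (fun z => x n z - y z) (fun z => x n z - y z))).
  - apply: nearW => n; have d2 := L2B (x2 n) y2.
    rewrite (ub _ d2) andbT; apply: le_trans (lb _ d2).
    by rewrite mulr_ge0 ?rdot_ge0// ltW.
  - exact: cvg_cst.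
  - by rewrite -[X in _ --> X](mulr0 2); exact: cvgMr.
by move=> g Hg gv; exists g.
Qed.
End HardyProjection.

(** * The Toeplitz operator of an indicator function *)

Section ToeplitzOperator.
Variable R : realType.
Local Notation C := R[i].
Local Notation T := (@circle R).
Implicit Types (u v w : C -> C) (mu : R).

Lemma angles0 : angles (set0 : set C) = set0.
Proof. by apply/seteqP; split => t // []. Qed.

(** The degenerate weight [J = set0], [mu = 0] turns [weighted_projection] into
    the existence of the point chosen by [Pplus]. *)
Lemma PplusP v : L2 T v ->
  H2 (Pplus v) /\ forall w, H2 w -> rdot (Pplus v) w = rdot v w.
Proof.
move=> v2; suff : [set g | H2 g /\
    forall w, H2 w -> inner (fun z => v z - g z) w = 0] (Pplus v).
  move=> [Hp pv]; split=> // w Hw; have := congr1 (@complex.Re R) (pv _ Hw).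
  rewrite -[LHS]/(rdot _ _) (rdotBl v2 (H2_L2 Hp) (H2_L2 Hw)) => /eqP.
  by rewrite subr_eq0 => /eqP.
apply: xgetPex; have m0 : measurable (angles (set0 : set C)).
  by rewrite angles0; exact: measurable0.
have [|g Hg gv] := @weighted_projection R set0 0 v m0 _ v2.
  by rewrite normr0.
exists g; split => // w Hw.
have g2 := H2_L2 Hg; have w2 := H2_L2 Hw.
apply/(inner_eq0P (L2B v2 g2) w2) => c.
rewrite (rdotBl v2 g2 (L2Z c w2)) -(gv _ (H2Z c Hw)) mul0r addr0.
exact: subrr.
Qed.

Variable J : set C.
Hypothesis mJ : measurable (angles J).
Local Notation phi := (toeplitz J).

Lemma H2_toeplitz u : H2 u -> H2 (phi u).
Proof. by move=> Hu; have [] := PplusP (L2_cutoff mJ (H2_L2 Hu)). Qed.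

Lemma rdot_toeplitz u w : H2 u -> H2 w -> rdot (phi u) w = rdot (cutoff J u) w.
Proof.
by move=> Hu Hw; have [_] := PplusP (L2_cutoff mJ (H2_L2 Hu)); apply.
Qed.

Lemma toeplitz_sym u w : H2 u -> H2 w -> rdot (phi u) w = rdot u (phi w).
Proof.
move=> Hu Hw.
by rewrite rdot_toeplitz// rdot_cutoffC rdotC -rdot_toeplitz// rdotC.
Qed.

Lemma H2_iter_toeplitz k u : H2 u -> H2 (iter k phi u).
Proof. by move=> Hu; elim: k => [|k IH]; [exact Hu|exact (H2_toeplitz IH)]. Qed.

Lemma iter_toeplitz_sym k u w : H2 u -> H2 w ->
  rdot (iter k phi u) w = rdot u (iter k phi w).
Proof.
move=> Hu; elim: k w => [|k IH] w Hw; first by [].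
rewrite iterS (toeplitz_sym (H2_iter_toeplitz k Hu) Hw).
by rewrite (IH _ (H2_toeplitz Hw)) iterSr.
Qed.

(** [|phi u|^2 = <1_J u, phi u> <= |1_J u| |phi u|]. *)
Lemma toeplitz_contraction u : H2 u -> rdot (phi u) (phi u) <= rdot u u.
Proof.
move=> Hu; have Hp := H2_toeplitz Hu; have u2 := H2_L2 Hu.
have := rdot_cutoff_le mJ u2; apply: le_trans.
have := rdot_cauchy_schwarz (L2_cutoff mJ u2) (H2_L2 Hp).
rewrite -rdot_toeplitz// rdot_cutoff2.
have [->|] := eqVneq (rdot (phi u) (phi u)) 0.
  by rewrite -rdot_cutoff2 rdot_ge0.
move=> p0; rewrite expr2 ler_pM2r//.
by rewrite lt_neqAle eq_sym p0 rdot_ge0.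
Qed.

Lemma iter_toeplitz_bound k u : H2 u -> `|rdot (iter k phi u) u| <= rdot u u.
Proof.
move=> Hu; have Hk := H2_iter_toeplitz k Hu.
rewrite -ler_sqr ?nnegrE ?rdot_ge0// real_normK ?num_real//.
apply: le_trans (rdot_cauchy_schwarz (H2_L2 Hk) (H2_L2 Hu)) _.
rewrite expr2 ler_wpM2r ?rdot_ge0//.
elim: k {Hk} => [|k]; first exact: lexx.
exact: le_trans (toeplitz_contraction (H2_iter_toeplitz k Hu)).
Qed.

Lemma inner_conj u v : L2 T u -> L2 T v -> inner v u = (inner u v)^*.
Proof.
move=> u2 v2; rewrite !inner_rdot rdotC; apply/eqP.
rewrite eq_complex/= eqxx/=; apply/eqP.
rewrite rdotC rdot_mul -mulN1r -(rdotZl (-1) u2 (L2Z 'i v2)).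
rewrite [RHS]rdot_mul; apply: rdot_ext => // z _.
by case: (v z) => a b; apply/eqP; rewrite eq_complex/=; apply/andP; split;
  apply/eqP; ring.
Qed.

Lemma inner_toeplitz_sym u w : H2 u -> H2 w ->
  inner (phi u) w = inner u (phi w).
Proof.
move=> Hu Hw; rewrite !inner_rdot toeplitz_sym//; congr (_ +i* _).
have Hiu := H2Z ('i)^* Hu.
have adj x y : rdot x (fun z => 'i * y z) = rdot (fun z => ('i)^* * x z) y.
  by rewrite rdot_mul; apply: rdot_ext => // z _; rewrite conjCK.
rewrite (rdot_toeplitz Hu (H2Z 'i Hw)) !adj -(toeplitz_sym Hiu Hw).
rewrite (rdot_toeplitz Hiu Hw); apply: rdot_ext => // z _.
by rewrite /cutoff mulrCA.
Qed.

(** Powers of a symmetric operator have real diagonal coefficients; this is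
    what reduces the two expansions to real series. *)
Lemma inner_iter_toeplitz_real k u : H2 u ->
  inner (iter k phi u) u = (rdot (iter k phi u) u)%:C.
Proof.
move=> Hu; have Hk := H2_iter_toeplitz k Hu.
have sym w : H2 w -> inner (iter k phi u) w = inner u (iter k phi w).
  elim: k w {Hk} => [|k IH] w Hw; first by [].
  rewrite iterS (inner_toeplitz_sym (H2_iter_toeplitz k Hu) Hw).
  by rewrite (IH _ (H2_toeplitz Hw)) iterSr.
have := sym _ Hu; rewrite [RHS](inner_conj (H2_L2 Hk) (H2_L2 Hu)).
rewrite /rdot; case: (inner _ _) => a b /eqP.
rewrite eq_complex/= eqxx/= => /eqP bN; congr (_ +i* _); lra.
Qed.

(** The weak solution given by [weighted_projection] solves the equation almost
    everywhere, because the residual lies in H^2 and is orthogonal to H^2,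
    hence to itself. *)
Lemma toeplitz_invP mu w : `|mu| < 1 -> H2 w ->
  H2 (toeplitz_inv J mu w) /\
  forall v, H2 v -> rdot (toeplitz_inv J mu w) v +
    mu * rdot (cutoff J (toeplitz_inv J mu w)) v = rdot w v.
Proof.
move=> mu1 Hw; have w2 := H2_L2 Hw; have eqD g v : H2 g -> H2 v ->
    rdot (fun z => g z + mu%:C * phi g z) v =
    rdot g v + mu * rdot (cutoff J g) v.
  move=> Hg Hv; have Hp := H2_toeplitz Hg.
  rewrite (rdotDl (H2_L2 Hg) (L2Z mu%:C (H2_L2 Hp)) (H2_L2 Hv)).
  by rewrite (rdotZl mu (H2_L2 Hp) (H2_L2 Hv)) (rdot_toeplitz Hg Hv).
have H2S g : H2 g -> H2 (fun z => g z + mu%:C * phi g z).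
  by move=> Hg; exact (H2D Hg (H2Z mu%:C (H2_toeplitz Hg))).
suff : [set g | H2 g /\
    eq_ae_on T (fun z => g z + mu%:C * phi g z) w] (toeplitz_inv J mu w).
  move=> [Hg gw]; split => // v Hv; rewrite -(eqD _ _ Hg Hv).
  exact (rdot_ae gw (H2_L2 (H2S _ Hg)) w2 (H2_L2 Hv)).
apply: xgetPex; have [g Hg gw] := weighted_projection mJ mu1 w2.
exists g; split => //; have s2 := H2_L2 (H2S _ Hg).
set d := fun z => (g z + mu%:C * phi g z) - w z.
have Hd : H2 d.
  have := H2D (H2S _ Hg) (H2Z (-1) Hw).
  by rewrite (_ : (fun z => _) = d)//; apply/funext => z; rewrite mulN1r.
have d0 : rdot d d = 0.
  have d2 := H2_L2 Hd.
  by rewrite {1}/d (rdotBl s2 w2 d2) (eqD _ _ Hg Hd) (gw _ Hd) subrr.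
apply: filterS (rdot_eq0 (H2_L2 Hd) d0) => t h tT; have := h tT.
by rewrite /d/= => /eqP; rewrite subr_eq0 => /eqP.
Qed.

(** [v] stands for [(1 + mu phi)^-1 xi]; substituting [xi = v + mu phi v] in
    both arguments and moving powers of [phi] to the left gives the three
    terms. *)
Lemma iter_toeplitz_resolvent mu xi v k : H2 xi -> H2 v ->
  (forall w, H2 w -> rdot v w + mu * rdot (cutoff J v) w = rdot xi w) ->
  rdot (iter k phi xi) xi = rdot (iter k phi v) v +
    2 * mu * rdot (iter k.+1 phi v) v + mu ^+ 2 * rdot (iter k.+2 phi v) v.
Proof.
move=> Hxi Hv vxi; have Hvk j := H2_iter_toeplitz j Hv.
have stepw j w : H2 w -> rdot (iter j phi xi) w =
    rdot (iter j phi v) w + mu * rdot (iter j.+1 phi v) w.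
  move=> Hw; have Hj := H2_iter_toeplitz j Hw.
  rewrite (iter_toeplitz_sym j Hxi Hw) -(vxi _ Hj) -(rdot_toeplitz Hv Hj).
  by rewrite (toeplitz_sym Hv Hj) -iterS !(iter_toeplitz_sym _ Hv Hw).
have sym0 j : rdot (iter j phi v) xi =
    rdot (iter j phi v) v + mu * rdot (iter j.+1 phi v) v.
  rewrite rdotC -(vxi _ (Hvk j)) -(rdot_toeplitz Hv (Hvk j)).
  by rewrite (toeplitz_sym Hv (Hvk j)) -iterS !(rdotC v).
rewrite (stepw k _ Hxi) !sym0.
move: (rdot (iter k.+2 _ _) _) (rdot (iter k.+1 _ _) _) => a1 a2.
ring.
Qed.
End ToeplitzOperator.

(** * Telescoping power series *)

Section WeightedSeries.
Variable R : realType.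
Implicit Types (c a : nat -> R) (q p mu : R).

(** With [r ^+ 2 = |mu|], the sequence [n r^n] is bounded by [(1 - r)^-1] and
    the remaining factor [r^n] tends to 0. *)
Lemma cvg_natmul_expr mu : `|mu| < 1 -> n%:R * mu ^+ n @[n --> \oo] --> (0 : R).
Proof.
move=> mu1; pose r := Num.sqrt `|mu|.
have rE : r ^+ 2 = `|mu| by rewrite sqr_sqrtr.
have r0 : 0 <= r by exact: sqrtr_ge0.
have r1 : r < 1 by rewrite -(ltr_pXn2r (n := 2)) ?nnegrE// rE expr1n.
have bound n : n%:R * r ^+ n <= (1 - r)^-1.
  rewrite -[leRHS]mul1r ler_pdivlMr ?subr_gt0//.
  suff : n%:R * r ^+ n * (1 - r) <= 1 - r ^+ n.
    by move/le_trans; apply; rewrite lerBlDr lerDl exprn_ge0.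
  elim: n => [|n IH]; first by rewrite mul0r mul0r expr0 subrr.
  have rn0 : 0 <= r ^+ n by rewrite exprn_ge0.
  have rn1 : r ^+ n <= 1 by rewrite exprn_ile1// ltW.
  rewrite exprS -natr1.
  have n0 : 0 <= (n%:R : R) by rewrite ler0n.
  have h1 := ler_wpM2l r0 IH.
  have h2 : 0 <= (1 - r) * (1 - r * r ^+ n).
    by rewrite mulr_ge0// ?subr_ge0 ?mulr_ile1// ltW.
  move: h1 h2; set x := n%:R; set y := r ^+ n; lra.
apply/norm_cvg0P; apply: (squeeze_cvgr (f := cst 0)
  (h := fun n => (1 - r)^-1 * r ^+ n)).
- apply: nearW => n; rewrite normr_ge0/= normrM normr_nat normrX -rE -exprM.
  by rewrite mulSn mul1n exprD mulrA ler_wpM2r ?exprn_ge0.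
- exact: cvg_cst.
- rewrite -[X in _ --> X](mulr0 (1 - r)^-1); apply: cvgMr; apply: cvg_expr.
  by rewrite ger0_norm.
Qed.

(** Summation by parts: the general term is [H k - H (k + 1)] for [H k = (q k +
    p) c k - (q k + p - q) c (k + 1)]. *)
Lemma cvg_second_difference c q p m : c n @[n --> \oo] --> 0 ->
  n%:R * c n @[n --> \oo] --> 0 ->
  \sum_(m <= k < n) (q * k%:R + p) * (c k - 2 * c k.+1 + c k.+2)
    @[n --> \oo] -->
  (q * m%:R + p) * c m - (q * m%:R + p - q) * c m.+1.
Proof.
move=> c0 nc0.
pose H k := (q * k%:R + p) * c k - (q * k%:R + p - q) * c k.+1.
have sumE n : (m <= n)%N ->
    \sum_(m <= k < n) (q * k%:R + p) * (c k - 2 * c k.+1 + c k.+2) = H m - H n.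
  move=> mn; rewrite -opprB -(telescope_sumr H mn) -sumrN.
  by apply: eq_bigr => k _; rewrite /H -natr1; ring.
have H0 : H n @[n --> \oo] --> (0 : R).
  have c10 : c n.+1 @[n --> \oo] --> 0 by rewrite -(cvg_shiftS c) in c0.
  have nc10 : n.+1%:R * c n.+1 @[n --> \oo] --> 0.
    by rewrite -(cvg_shiftS (fun n => n%:R * c n)) in nc0.
  rewrite (_ : H = (fun n => q * (n%:R * c n) + p * c n +
      (- q * (n.+1%:R * c n.+1) + (2 * q - p) * c n.+1))); last first.
    by apply/funext => n; rewrite /H -natr1; ring.
  rewrite (_ : 0 = q * 0 + p * 0 + (- q * 0 + (2 * q - p) * 0) :> R);
    last by ring.
  by apply: cvgD; apply: cvgD; exact: cvgMr.
rewrite -/(H m) -[X in _ --> X]subr0.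
have : H m - H n @[n --> \oo] --> H m - 0 by apply: cvgB; [exact: cvg_cst|].
apply: cvg_trans; apply: near_eq_cvg.
by near=> n; rewrite sumE//; near: n; exact: nbhs_infty_ge.
Unshelve. all: by end_near.
Qed.

Lemma cvg_bounded_expr a (K mu : R) : `|mu| < 1 -> (forall n, `|a n| <= K) ->
  (- mu) ^+ n * a n @[n --> \oo] --> 0 /\
  n%:R * ((- mu) ^+ n * a n) @[n --> \oo] --> 0.
Proof.
move=> mu1 aK; have K0 : 0 <= K by exact: le_trans (normr_ge0 _) (aK 0%N).
have mul0 (x : nat -> R) : x n @[n --> \oo] --> 0 ->
    x n * a n @[n --> \oo] --> 0.
  move=> x0; apply/cvgr0Pnorm_le => e e0.
  have e' : 0 < e / (K + 1) by rewrite divr_gt0// ltr_wpDl.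
  have /cvgr0Pnorm_le/(_ _ e') := x0.
  apply: filterS => n xn; rewrite normrM.
  apply: (@le_trans _ _ (e / (K + 1) * (K + 1))); last first.
    by rewrite divfK// gt_eqF// ltr_wpDl.
  apply: ler_pM => //.
  by apply: le_trans (aK n) _; rewrite lerDl.
have Nmu1 : `|- mu| < 1 by rewrite normrN.
split; first by apply: mul0; exact: cvg_expr.
under eq_fun do rewrite mulrA.
by apply: mul0; exact: cvg_natmul_expr.
Qed.
End WeightedSeries.

Section ResolventSeries.
Variable R : realType.
Variables (mu K : R) (a F : nat -> R).
Hypothesis mu1 : `|mu| < 1.
Hypothesis aK : forall n, `|a n| <= K.
Hypothesis FE : forall k, F k = a k + 2 * mu * a k.+1 + mu ^+ 2 * a k.+2.

Let c k := (- mu) ^+ k * a k.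

Let c0 : c n @[n --> \oo] --> 0 := (cvg_bounded_expr mu1 aK).1.

Let nc0 : n%:R * c n @[n --> \oo] --> 0 := (cvg_bounded_expr mu1 aK).2.

Let term k : (-1) ^+ k * F k * mu ^+ k.+1 =
  mu * (c k - 2 * c k.+1 + c k.+2).
Proof. by rewrite FE /c !exprS (exprNn mu); ring. Qed.

Lemma resolvent_series :
  \sum_(0 <= k < n) (-1) ^+ k * F k * mu ^+ k.+1 @[n --> \oo] -->
  mu * a 0%N + mu ^+ 2 * a 1%N.
Proof.
have := cvg_second_difference (q := 0) (p := 1) (m := 0%N) c0 nc0.
move=> /(cvgMr (a := mu)); under eq_fun do rewrite mulr_sumr.
rewrite (_ : mu * (_ - _) = mu * a 0%N + mu ^+ 2 * a 1%N); last first.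
  by rewrite /c !exprS !expr0; ring.
apply: cvg_trans; apply: near_eq_cvg; apply: nearW => n /=.
by apply: eq_bigr => k _; rewrite term; ring.
Qed.

Lemma resolvent_series_weighted :
  \sum_(0 <= k < n) (-1) ^+ k * (k + 2)%:R * F k * mu ^+ k.+1 @[n --> \oo] -->
  2 * mu * a 0%N + mu ^+ 2 * a 1%N.
Proof.
have := cvg_second_difference (q := 1) (p := 2) (m := 0%N) c0 nc0.
move=> /(cvgMr (a := mu)); under eq_fun do rewrite mulr_sumr.
rewrite (_ : mu * (_ - _) = 2 * mu * a 0%N + mu ^+ 2 * a 1%N); last first.
  by rewrite /c !exprS !expr0; ring.
apply: cvg_trans; apply: near_eq_cvg; apply: nearW => n /=.
apply: eq_bigr => k _; have := term k; rewrite natrD => t.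
transitivity ((k%:R + 2) * ((-1) ^+ k * F k * mu ^+ k.+1)).
  by rewrite t; ring.
by ring.
Qed.

(** After the shift [k = j + 1] the general term is [j + 1] times the second
    difference of [mu c (j + 1) + mu^2 c j], where [c j = (- mu)^j a j]. *)
Lemma resolvent_series_diff :
  \sum_(1 <= k < n) (-1) ^+ k * k%:R * (F k - F k.-1) * mu ^+ k.+1
    @[n --> \oo] --> mu ^+ 2 * (a 0%N - a 1%N).
Proof.
rewrite -cvg_shiftS /=; under eq_fun do rewrite big_add1 /=.
pose e k := mu * c k.+1 + mu ^+ 2 * c k.
have c1 : c n.+1 @[n --> \oo] --> 0 by have := c0; rewrite -(cvg_shiftS c).
have nc1 : n.+1%:R * c n.+1 @[n --> \oo] --> 0.
  by have := nc0; rewrite -(cvg_shiftS (fun n => n%:R * c n)).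
have e0 : e n @[n --> \oo] --> 0.
  rewrite (_ : 0 = mu * 0 + mu ^+ 2 * 0); last by ring.
  by apply: cvgD; exact: cvgMr.
have ne0 : n%:R * e n @[n --> \oo] --> 0.
  rewrite (_ : (fun n => _) = (fun n => mu * (n.+1%:R * c n.+1) +
      (- mu * c n.+1 + mu ^+ 2 * (n%:R * c n)))); last first.
    by apply/funext => n; rewrite /e -natr1; ring.
  rewrite (_ : 0 = mu * 0 + (- mu * 0 + mu ^+ 2 * 0)); last by ring.
  by apply: cvgD; [|apply: cvgD]; exact: cvgMr.
have := cvg_second_difference (q := 1) (p := 1) (m := 0%N) e0 ne0.
rewrite (_ : _ * e 0%N - _ = mu ^+ 2 * (a 0%N - a 1%N)); last first.
  by rewrite /e /c !exprS !expr0; ring.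
apply: cvg_trans; apply: near_eq_cvg; apply: nearW => n /=.
apply: eq_bigr => k _.
transitivity (k.+1%:R * ((-1) ^+ k.+1 * F k.+1 * mu ^+ k.+2 +
   mu * ((-1) ^+ k * F k * mu ^+ k.+1))).
  by rewrite !term /e -natr1; ring.
by rewrite !exprS; ring.
Qed.
End ResolventSeries.

Lemma has_sum_from_real (R : realType) (m : nat) (u : nat -> R[i])
    (t : nat -> R) (s : R) : (forall k, (m <= k)%N -> u k = (t k)%:C) ->
  \sum_(m <= k < n) t k @[n --> \oo] --> s -> has_sum_from m u s%:C.
Proof.
move=> ut ts; rewrite /has_sum_from; apply/cvgrPdist_lt => -[e e'].
rewrite ltcE/= => /andP[/eqP -> e0].
have /cvgrPdist_lt/(_ _ e0) := ts; apply: filterS => n.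
rewrite (_ : \sum_(m <= k < n) u k = (\sum_(m <= k < n) t k)%:C); last first.
  rewrite rmorph_sum/=; apply: eq_big_nat => k /andP[mk _].
  exact: ut.
rewrite -rmorphB/= => h.
by rewrite normc_def/= expr0n addr0 sqrtr_sqr ltcR.
Qed.

(** * Unimodularity of Blaschke products *)

Section Blaschke.
Variable R : realType.
Local Notation C := R[i].
Local Notation T := (@circle R).

(** On the circle [1 - conj z x = x conj (x - z)], so every factor is
    unimodular; its denominator does not vanish because [|z| < 1 = |x|]. *)
Lemma blaschke_circle (phi0 : R) N (z : 'I_N -> C) :
  (forall j, `|z j| < 1) ->
  circle_measurable (blaschke phi0 z) /\
  forall x, T x -> sqmod (blaschke phi0 z x) = 1.
Proof.
move=> z1.
have den x j : T x -> sqmod (1 - (z j)^* * x) = sqmod (x - z j).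
  move=> Tx; have x1 := sqmod_circle Tx.
  rewrite -[RHS]mul1r -x1 -(sqmodC (x - z j)) -sqmodM; congr sqmod.
  by rewrite rmorphB/= mulrBr sqmod_conj x1 mulrC.
have num x j : T x -> x - z j != 0.
  move=> Tx; rewrite subr_eq0; apply/eqP => xz.
  by have := z1 j; rewrite -xz Tx ltxx.
have den0 x j : T x -> 1 - (z j)^* * x != 0.
  by move=> Tx; rewrite -sqmod_eq0 den// sqmod_eq0 num.
split.
  apply: circle_measurableM; first exact (circle_measurable_cst (cis phi0)).
  elim: (index_enum _) => [|j s IH].
    apply: circle_measurable_ext (circle_measurable_cst 1) => x _.
    by rewrite big_nil.
  have mj : circle_measurable (fun x => (x - z j) / (1 - (z j)^* * x)).
    apply: circle_measurableM.
      exact (circle_measurableB (circle_measurable_id R)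
        (circle_measurable_cst (z j))).
    apply: (circle_measurableV (u := fun x => 1 - (z j)^* * x)).
      exact (circle_measurableB (circle_measurable_cst 1)
        (circle_measurableM (circle_measurable_cst (z j)^*)
           (circle_measurable_id R))).
    by move=> x; exact: den0.
  apply: circle_measurable_ext (circle_measurableM mj IH) => x _.
  by rewrite big_cons.
move=> x Tx; rewrite sqmodM (sqmod_circle (cis_circle phi0)) mul1r.
apply: (big_ind (fun y => sqmod y = 1)); first exact: sqmod1.
  by move=> y y' e e'; rewrite sqmodM e e' mulr1.
by move=> j _; rewrite sqmodM sqmodV den// mulfV// sqmod_eq0 num.
Qed.
End Blaschke.

(** * Errors of the extremal functions on the two parts of the circle *)

Section ExtremalErrors.
Variable R : realType.
Local Notation C := R[i].
Local Notation T := (@circle R).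
Implicit Types (u v w : C -> C).

(** Functions equal on the circle define the same set of candidates, so the
    same representative is chosen: here equality is not merely almost
    everywhere. *)
Lemma Pplus_ext u v : {in T, u =1 v} -> Pplus u = Pplus v.
Proof.
move=> uv; rewrite /Pplus; congr xget; apply/seteqP; split => x /= [Hx h];
  split => // w Hw; rewrite -(h w Hw); apply: inner_ext => // z zT;
  by rewrite uv.
Qed.

Variables (I J : set C) (p : C -> C).
Hypothesis JE : J = T `\` I.
Hypothesis mJ : measurable (angles J).
Hypothesis p2 : L2 T p.
Local Notation phi := (toeplitz J).

Lemma cutoff_compl u : {in T, cutoff I u =1 fun z => u z - cutoff J u z}.
Proof.
move=> z; rewrite inE => Tz; rewrite /cutoff !indicE JE mem_circle_setD//.
by case: (z \in I) => /=; rewrite ?mul1r ?mul0r ?subr0 ?subrr.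
Qed.

Variable g0 : C -> C.
Hypothesis Hg0 : H2 g0.
Hypothesis g0E : forall w, H2 w -> rdot g0 w = rdot p w.

Let g02 : L2 T g0 := H2_L2 Hg0.
Let d2 : L2 T (fun z => g0 z - p z) := L2B g02 p2.
Let cp2 : L2 T (cutoff J p) := L2_cutoff mJ p2.

(** This is [xi0], written with [p]. *)
Definition defect (z : C) : C := phi (Pplus p) z - Pplus (cutoff J p) z.

Lemma H2_defect : H2 defect.
Proof.
have := H2D (H2_toeplitz mJ (PplusP p2).1) (H2Z (-1) (PplusP cp2).1).
by rewrite (_ : (fun z => _) = defect)//; apply/funext => z; rewrite mulN1r.
Qed.

(** [phi (P_+ p)] may be tested with [g0] in place of [P_+ p] once [phi] has
    been moved to the other side, where the test function is again in H^2. *)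
Lemma rdot_defect w : H2 w ->
  rdot defect w = rdot (cutoff J (fun z => g0 z - p z)) w.
Proof.
move=> Hw; have w2 := H2_L2 Hw; have Hpw := H2_toeplitz mJ Hw.
have [HA AE] := PplusP p2; have [HB BE] := PplusP cp2.
rewrite [LHS](rdotBl (H2_L2 (H2_toeplitz mJ HA)) (H2_L2 HB) w2) (BE w Hw).
rewrite (toeplitz_sym mJ HA Hw) (AE _ Hpw) -(g0E Hpw).
rewrite -(toeplitz_sym mJ Hg0 Hw) (rdot_toeplitz mJ Hg0 Hw).
rewrite -(rdotBl (L2_cutoff mJ g02) cp2 w2).
by apply: rdot_ext => // z _; rewrite /cutoff mulrBr.
Qed.

Variables (mu : R) (g : C -> C).
Hypothesis Hg : H2 g.
Hypothesis gE : forall w, H2 w -> rdot g w + mu * rdot (cutoff J g) w =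
  rdot p w + mu * rdot (cutoff J p) w.

Lemma resolvent_exists : mu != 0 -> exists v, [/\ H2 v,
  forall w, H2 w -> rdot v w + mu * rdot (cutoff J v) w = rdot defect w &
  forall z, g z = g0 z + (- mu)%:C * v z].
Proof.
move=> mu0; have g2 := H2_L2 Hg.
pose d z := g0 z + (-1) * g z.
have Hd : H2 d by exact (H2D Hg0 (H2Z (-1) Hg)).
exists (fun z => mu^-1%:C * d z); split; first exact (H2Z _ Hd).
  move=> w Hw; have w2 := H2_L2 Hw; have cw2 := L2_cutoff mJ w2.
  have dE x : L2 T x -> rdot d x = rdot g0 x - rdot g x.
    move=> x2; rewrite -(rdotBl g02 g2 x2).
    by apply: rdot_ext => // z _; rewrite /d mulN1r.
  rewrite rdot_cutoffC (rdotZl _ (H2_L2 Hd) w2) (rdotZl _ (H2_L2 Hd) cw2).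
  rewrite (rdot_defect Hw) rdot_cutoffC (rdotBl g02 p2 cw2).
  rewrite (dE _ w2) (dE _ cw2) (g0E Hw).
  have e := gE Hw; rewrite (rdot_cutoffC J g) (rdot_cutoffC J p) in e.
  apply: (mulfI mu0); move: e.
  move: (rdot g w) (rdot g (cutoff J w)) (rdot p w) (rdot p (cutoff J w)).
  move: (rdot g0 (cutoff J w)).
  move=> x5 x1 x2 x3 x4 e; have -> : x1 = x3 + mu * x4 - mu * x2.
    by rewrite -e addrK.
  by field.
move=> z; have -> : (- mu)%:C * (mu^-1%:C * d z) = - d z.
  by rewrite mulrA -rmorphM/= mulNr mulfV// rmorphN1 mulN1r.
by rewrite /d mulN1r opprB addrC subrK.
Qed.

Variable v : C -> C.
Hypothesis Hv : H2 v.
Hypothesis vE :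
  forall w, H2 w -> rdot v w + mu * rdot (cutoff J v) w = rdot defect w.
Hypothesis gvE : forall z, g z = g0 z + (- mu)%:C * v z.

Let v2 : L2 T v := H2_L2 Hv.

(** The cross term is [<1_J (g0 - p), v> = <xi0, v> = <v, v> + mu <phi v, v>].
    *)
Lemma error_on_J :
  rdot (cutoff J (fun z => g z - p z)) (cutoff J (fun z => g z - p z)) =
  rdot (cutoff J (fun z => g0 z - p z)) (cutoff J (fun z => g0 z - p z)) -
  (2 * mu * rdot v v + mu ^+ 2 * rdot (phi v) v).
Proof.
set q := cutoff J (fun z => g0 z - p z).
have q2 : L2 T q := L2_cutoff mJ d2.
have cv2 := L2_cutoff mJ v2.
have -> : cutoff J (fun z => g z - p z) =
    (fun z => q z + (- mu)%:C * cutoff J v z).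
  by apply/funext => z; rewrite /q /cutoff gvE; ring.
rewrite (rdot_sqDZ (- mu) q2 cv2) [rdot q (cutoff J v)]rdot_cutoff2.
rewrite -(rdot_defect Hv) -(vE Hv) rdot_cutoff2 (rdot_toeplitz mJ Hv Hv).
move: (rdot q q) (rdot v v) (rdot (cutoff J v) v) => x y z; ring.
Qed.

(** On the circle [1_I = 1 - 1_J], and [g0 - p] is orthogonal to H^2, so the
    cross term is the opposite of the one on [J]. *)
Lemma error_on_I :
  rdot (cutoff I (fun z => g z - p z)) (cutoff I (fun z => g z - p z)) =
  rdot (cutoff I (fun z => g0 z - p z)) (cutoff I (fun z => g0 z - p z)) +
  2 * (mu * rdot v v + mu ^+ 2 * rdot (phi v) v) +
  mu ^+ 2 * (rdot v v - rdot (phi v) v).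
Proof.
have cut_ext u : L2 T u -> L2 T (cutoff I u).
  move=> u2; apply: L2_ext (L2B u2 (L2_cutoff mJ u2)) => z Tz.
  by rewrite cutoff_compl.
have cutI u : L2 T u -> rdot (cutoff I u) v = rdot u v - rdot (cutoff J u) v.
  move=> u2; rewrite -(rdotBl u2 (L2_cutoff mJ u2) v2).
  by apply: rdot_ext => //; exact: cutoff_compl.
set q := cutoff I (fun z => g0 z - p z).
have q2 : L2 T q := cut_ext _ d2.
have cv2 := cut_ext _ v2.
have -> : cutoff I (fun z => g z - p z) =
    (fun z => q z + (- mu)%:C * cutoff I v z).
  by apply/funext => z; rewrite /q /cutoff gvE; ring.
rewrite (rdot_sqDZ (- mu) q2 cv2) [rdot q (cutoff I v)]rdot_cutoff2.
rewrite rdot_cutoff2 (cutI _ d2) (cutI _ v2).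
rewrite (rdotBl g02 p2 v2) (g0E Hv) subrr sub0r.
rewrite -(rdot_defect Hv) -(vE Hv) (rdot_toeplitz mJ Hv Hv).
move: (rdot q q) (rdot v v) (rdot (cutoff J v) v) => x y z; ring.
Qed.
End ExtremalErrors.

(** On the circle [psi + b G - k = b (G - conj b (k - psi))] and [|b| = 1]. *)
Lemma normL2_unimodular (R : realType) (A : set R[i])
    (b psi k p G : R[i] -> R[i]) :
  (forall x, circle x -> sqmod (b x) = 1) ->
  (forall x, circle x -> A x -> p x = (b x)^* * (k x - psi x)) ->
  normL2 A (fun x => psi x + b x * G x - k x) ^+ 2 =
  rdot (cutoff A (fun x => G x - p x)) (cutoff A (fun x => G x - p x)).
Proof.
move=> b1 pE; rewrite normL2_sqE.
have bb x : circle x -> b x * (b x)^* = 1.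
  by move=> Tx; rewrite sqmod_conj b1.
set u := cutoff A (fun x => G x - p x).
transitivity (rdot (fun x => b x * u x) (fun x => b x * u x)).
  have e : {in @circle R, (fun x => \1_A x * (psi x + b x * G x - k x)) =1
      fun x => b x * u x}.
    move=> x; rewrite inE => Tx; rewrite /u /cutoff indicE.
    have [|] := boolP (x \in A); last by rewrite !mul0r mulr0.
    rewrite inE => Ax; rewrite !mul1r (pE _ Tx Ax) mulrBr mulrA bb// mul1r.
    by ring.
  exact: rdot_ext.
rewrite rdot_mul; apply: rdot_ext => // x; rewrite inE => Tx.
by rewrite mulrA [_^* * _]mulrC bb// mul1r.
Qed.

Section PerturbationExpansion.
Variable R : realType.
Local Notation C := R[i].
Local Notation T := (@circle R).
Implicit Types (u v w : C -> C).

Variables (I J : set C).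
Hypothesis JE : J = T `\` I.
Hypothesis mJ : measurable (angles J).

Lemma vee_scale (u v : C -> C) (a : C) :
  {in T, vee I u (fun x => (1 + a) * v x) =1
   fun x => vee I u v x + a * cutoff J (vee I u v) x}.
Proof.
move=> x; rewrite inE => Tx; rewrite /cutoff /vee indicE JE mem_circle_setD//.
case: (x \in I); rewrite /= ?mul0r ?mulr0 ?addr0//.
by rewrite mul1r mulrDl mul1r.
Qed.

Lemma vee_cutoff (u v : C -> C) :
  {in T, vee I (fun=> 0) v =1 cutoff J (vee I u v)}.
Proof.
move=> x; rewrite inE => Tx; rewrite /cutoff /vee indicE JE mem_circle_setD//.
by case: (x \in I); rewrite /= ?mul0r ?mul1r.
Qed.

Lemma vee_indic (u v : C -> C) :
  {in T, vee I u v =1 fun x => \1_I x * u x + \1_J x * v x}.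
Proof.
move=> x; rewrite inE => Tx; rewrite /vee !indicE JE mem_circle_setD//.
by case: (x \in I); rewrite /= ?mul0r ?mul1r ?add0r ?addr0.
Qed.

Variable p : C -> C.
Hypothesis p2 : L2 T p.
Local Notation phi := (toeplitz J).

(** In terms of [p] the function [g0 nu] depends on the data only through [p +
    nu 1_J p]. *)
Definition extremal (nu : R) : C -> C :=
  toeplitz_inv J nu (Pplus (fun x => p x + nu%:C * cutoff J p x)).

Lemma extremalP nu : `|nu| < 1 -> H2 (extremal nu) /\ forall w, H2 w ->
  rdot (extremal nu) w + nu * rdot (cutoff J (extremal nu)) w =
  rdot p w + nu * rdot (cutoff J p) w.
Proof.
move=> nu1; have cp2 := L2_cutoff mJ p2; have ncp2 := L2Z nu%:C cp2.
have [HP PE] := PplusP (L2D p2 ncp2).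
have [Hg ge] := toeplitz_invP mJ nu1 HP.
split; [exact Hg|move=> w Hw]; have w2 := H2_L2 Hw.
rewrite [LHS](ge w Hw) (PE w Hw).
by rewrite (rdotDl p2 ncp2 w2) (rdotZl nu cp2 w2).
Qed.

(** For [mu = 0] the factor [- mu] vanishes and any solution of the equation
    will do. *)
Lemma extremal_resolvent mu : `|mu| < 1 -> exists v, [/\ H2 v,
  forall w, H2 w -> rdot v w + mu * rdot (cutoff J v) w =
    rdot (defect J p) w &
  forall x, extremal mu x = extremal 0 x + (- mu)%:C * v x].
Proof.
move=> mu1; have [mu0|mu0] := eqVneq mu 0.
  exists (defect J p); split; first exact (H2_defect mJ p2).
    by move=> w _; rewrite mu0 mul0r addr0.
  by move=> x; rewrite mu0 oppr0 mul0r addr0.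
have lt01 : `|0 : R| < 1 by rewrite normr0.
have [H0 E0] := extremalP lt01; have [Hm Em] := extremalP mu1.
apply: (resolvent_exists mJ p2 H0 _ Hm Em mu0) => w Hw.
by have := E0 w Hw; rewrite !mul0r !addr0.
Qed.

(** With [a k = <phi^k v, v>] the three limits are [2 mu a 0 + mu^2 a 1], [mu a
    0 + mu^2 a 1] and [mu^2 (a 0 - a 1)], the very combinations left in the two
    errors. *)
Lemma extremal_expansion mu (F : nat -> R) : `|mu| < 1 ->
  (forall k, F k = rdot (iter k phi (defect J p)) (defect J p)) ->
  let errJ nu := rdot (cutoff J (fun x => extremal nu x - p x))
                      (cutoff J (fun x => extremal nu x - p x)) in
  let errI nu := rdot (cutoff I (fun x => extremal nu x - p x))
                      (cutoff I (fun x => extremal nu x - p x)) in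
  exists s1 s2 s3 : R, [/\
    \sum_(0 <= k < n) (-1) ^+ k * (k + 2)%:R * F k * mu ^+ k.+1
      @[n --> \oo] --> s1,
    \sum_(0 <= k < n) (-1) ^+ k * F k * mu ^+ k.+1 @[n --> \oo] --> s2,
    \sum_(1 <= k < n) (-1) ^+ k * k%:R * (F k - F k.-1) * mu ^+ k.+1
      @[n --> \oo] --> s3,
    errJ mu = errJ 0 - s1 & errI mu = errI 0 + 2 * s2 + s3].
Proof.
move=> mu1 FE errJ errI.
have lt01 : `|0 : R| < 1 by rewrite normr0.
have [H0 E0] := extremalP lt01.
have {}E0 w : H2 w -> rdot (extremal 0) w = rdot p w.
  by move=> Hw; have := E0 w Hw; rewrite !mul0r !addr0.
have [v [Hv vE gE]] := extremal_resolvent mu1.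
pose a k := rdot (iter k phi v) v.
have aK k : `|a k| <= rdot v v by exact: iter_toeplitz_bound mJ k v Hv.
have {}FE k : F k = a k + 2 * mu * a k.+1 + mu ^+ 2 * a k.+2.
  rewrite FE; exact: (iter_toeplitz_resolvent mJ k (H2_defect mJ p2) Hv vE).
exists (2 * mu * a 0%N + mu ^+ 2 * a 1%N), (mu * a 0%N + mu ^+ 2 * a 1%N),
  (mu ^+ 2 * (a 0%N - a 1%N)); split.
- exact: (resolvent_series_weighted mu1 aK FE).
- exact: (resolvent_series mu1 aK FE).
- exact: (resolvent_series_diff mu1 aK FE).
- exact (error_on_J mJ p2 H0 E0 Hv vE gE).
- exact (error_on_I JE mJ p2 H0 E0 Hv vE gE).
Qed.
End PerturbationExpansion.

Theorem proposition9 (R : realType) (I : set R[i]) (N : nat)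
    (z omega : 'I_N -> R[i]) (phi0 : R) (psi f h : R[i] -> R[i]) :
  let J := @circle R `\` I in
  let b := blaschke phi0 z in
  I `<=` @circle R -> measurable (angles I) ->
  (0 < leb_measure (angles I))%E ->
  (0 < leb_measure (angles J))%E ->
  injective z -> (forall j, `|z j| < 1) ->
  0 <= phi0 <= 2 * pi ->
  H2 psi -> (forall j, disk_value psi (z j) = omega j) ->
  L2 I f -> ~ traces I (interpolants psi b) f ->
  L2 J h ->
  let bf := fun x => (b x)^* * (f x - psi x) in
  let bh := fun x => (b x)^* * (h x - psi x) in
  let g0 := fun mu : R =>
    toeplitz_inv J mu (Pplus (vee I bf (fun x => (1 + mu)%:C * bh x))) in
  let M0 := fun mu : R => normL2 J (fun x => psi x + b x * g0 mu x - h x) in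
  let e := fun mu : R =>
    (normL2 I (fun x => psi x + b x * g0 mu x - f x)) ^+ 2 in
  let xi0 := fun x =>
    toeplitz J (Pplus (vee I bf bh)) x - Pplus (vee I (fun=> 0) bh) x in
  let F := fun k : nat => inner (iter k (toeplitz J) xi0) xi0 in
  forall mu : R, `|mu| < 1 ->
  (exists s : R[i],
      has_sum_from 0 (fun k => (-1) ^+ k * (k + 2)%:R * F k * mu%:C ^+ k.+1) s
      /\ (M0 mu ^+ 2)%:C = (M0 0 ^+ 2)%:C - s) /\
  (exists s1 s2 : R[i],
      [/\ has_sum_from 0 (fun k => (-1) ^+ k * F k * mu%:C ^+ k.+1) s1,
          has_sum_from 1
            (fun k => (-1) ^+ k * k%:R * (F k - F k.-1) * mu%:C ^+ k.+1) s2
        & (e mu)%:C = (e 0)%:C + 2 * s1 + s2]).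
Proof.
move=> J b IT mI _ _ _ z1 _ Hpsi _ f2 _ h2 bf bh g0 M0 e xi0 F mu mu1.
have [mb b1] := blaschke_circle phi0 z1.
have mJ : measurable (angles J).
  have -> : angles J = full_turn (R := R) `\` angles I.
    apply/seteqP; split => t /=.
      by move=> [tD [_ nI]]; split => // -[].
    move=> [tD nI]; split => //; split; first exact: cis_circle.
    by move=> It; apply: nI.
  by apply: measurableD => //; exact: measurable_full_turn.
have JE : J = @circle R `\` I by [].
pose p := vee I bf bh.
have p2 : L2 (@circle R) p.
  have s2 := L2B (L2D (L2_indic mI f2) (L2_indic mJ h2)) (H2_L2 Hpsi).
  have l2 := L2_mul (c := 1) (circle_measurable_conj mb) _ s2.
  apply: L2_ext (l2 _) => x Tx; last by rewrite sqmodC b1.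
  by rewrite -(vee_indic JE f h Tx) /p /vee; case: (x \in I).
have gE nu : g0 nu = extremal J p nu.
  rewrite /g0 /extremal; congr toeplitz_inv; apply: Pplus_ext => x Tx.
  by rewrite rmorphD (vee_scale JE).
have M0E nu : M0 nu ^+ 2 =
    rdot (cutoff J (fun x => extremal J p nu x - p x))
         (cutoff J (fun x => extremal J p nu x - p x)).
  rewrite /M0 gE.
  apply: (@normL2_unimodular _ J b psi h p (extremal J p nu) b1) => x Tx Jx.
  rewrite /p (vee_indic JE) ?inE// !indicE (mem_set Jx).
  by rewrite memNset ?mul0r ?add0r ?mul1r//; case: Jx.
have eE nu : e nu =
    rdot (cutoff I (fun x => extremal J p nu x - p x))
         (cutoff I (fun x => extremal J p nu x - p x)).
  rewrite /e gE.
  apply: (@normL2_unimodular _ I b psi f p (extremal J p nu) b1) => x Tx Ix.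
  by rewrite /p /vee mem_set.
have xi0E : xi0 = defect J p.
  apply/funext => x; rewrite /xi0 /defect.
  by rewrite (Pplus_ext (vee_cutoff JE bf bh)).
have FE k : F k = (rdot (iter k (toeplitz J) (defect J p)) (defect J p))%:C.
  rewrite /F xi0E; exact: (inner_iter_toeplitz_real mJ k (H2_defect mJ p2)).
have [|s1 [s2 [s3 [S1 S2 S3 errJ errI]]]] := extremal_expansion JE mJ p2
  (F := fun k => complex.Re (F k)) mu1; first by move=> k; rewrite FE.
have EJ : M0 mu ^+ 2 = M0 0 ^+ 2 - s1.
  exact (etrans (M0E mu)
    (etrans errJ (congr1 (fun y => y - s1) (esym (M0E 0))))).
have EI : e mu = e 0 + 2 * s2 + s3.
  exact (etrans (eE mu)
    (etrans errI (congr1 (fun y => y + 2 * s2 + s3) (esym (eE 0))))).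
have {}FE k : F k = (complex.Re (F k))%:C by rewrite FE.
clear M0E eE errJ errI gE; clearbody M0 e F.
split.
  exists s1%:C; split; last first.
    by rewrite EJ rmorphB.
  apply: has_sum_from_real S1 => k _.
  by rewrite [in LHS]FE !rmorphM/= !rmorphXn/= rmorphN1 rmorph_nat.
exists s2%:C, s3%:C; split; last first.
- by rewrite EI !rmorphD/= rmorphM/= rmorph_nat.
- apply: has_sum_from_real S3 => k _.
  rewrite [in LHS]FE [in X in _ - X]FE.
  by rewrite !rmorphM/= rmorphB/= !rmorphXn/= rmorphN1 rmorph_nat.
- apply: has_sum_from_real S2 => k _.
  by rewrite [in LHS]FE !rmorphM/= !rmorphXn/= rmorphN1.
Qed.
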